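(* Let $A$ be an associative conformal algebra. The degree $-1$ bracket $[-,-]:\mathcal C^m(A,A)\times\mathcal C^n(A,A)\to\mathcal C^{m+n-1}(A,A)$ ($m,n\ge 0$) on the Hochschild cochains $\bigoplus_{i\ge0}\mathcal C^i(A,A)$ induces a well-defined bracket $[-,-]:\mathrm{HH}^m(A)\times \mathrm{HH}^n(A)\to \mathrm{HH}^{m+n-1}(A)$ of degree $-1$ on $\bigoplus_{i\ge 0}\mathrm{HH}^i(A)$ such that $\big(\bigoplus_{i\ge0}\mathrm{HH}^i(A),[-,-]\big)$ is a graded Lie algebra, i.e. for $f\in\mathrm{HH}^m(A)$, $g\in\mathrm{HH}^n(A)$, $h\in\mathrm{HH}^p(A)$, $m,n,p\ge 0$, $$[f,g]=-(-1)^{(m-1)(n-1)}[g,f],\qquad [f,[g,h]]=[[f,g],h]+(-1)^{(m-1)(n-1)}[g,[f,h]].$$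
   Context: Base field: $\mathbb C$ denotes a fixed algebraically closed field of characteristic zero; all vector spaces, linear maps and tensor products are over $\mathbb C$. For a vector space $V$, $V[\lambda_1,\dots,\lambda_k]$ is the space of polynomials in $\lambda_1,\dots,\lambda_k$ with coefficients in $V$. All operations are extended coefficientwise to polynomial-valued arguments. Associative conformal algebra: a $\mathbb C[\partial]$-module $A$ with a bilinear map $A\times A\to A[\lambda]$, $(a,b)\mapsto a_{(\lambda)}b$, such that for all $a,b,c\in A$: $(\partial a)_{(\lambda)}b=-\lambda\, a_{(\lambda)}b$, $a_{(\lambda)}(\partial b)=(\partial+\lambda)(a_{(\lambda)}b)$, $(a_{(\lambda)}b)_{(\lambda+\mu)}c=a_{(\lambda)}(b_{(\mu)}c)$. If $a_{(\lambda)}b=\sum_k\lambda^kc_k$, then $a_{(-\partial)}b:=\sum_k(-\partial)^kc_k$; in general, substituting an expression involving $\partial$ for a variable means that the powers of that expression act on the coefficients. Hochschild complex: $\mathcal C^0(A,A)=A/\partial A$, $\mathcal C^1(A,A)=\mathrm{Hom}_{\mathbb C[\partial]}(A,A)$, and for $n\ge2$, $\mathcal C^n(A,A)$ is the space of conformal sesquilinear maps, i.e. linear maps $\varphi:A^{\otimes n}\to A[\lambda_1,\dots,\lambda_{n-1}]$ with $\varphi_{\lambda_1,\dots,\lambda_{n-1}}(a_1,\dots,\partial a_i,\dots,a_n)=-\lambda_i\varphi_{\lambda_1,\dots,\lambda_{n-1}}(a_1,\dots,a_n)$ for $1\le i\le n-1$, and $\varphi_{\lambda_1,\dots,\lambda_{n-1}}(a_1,\dots,a_{n-1},\partial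 a_n)=(\partial+\lambda_1+\dots+\lambda_{n-1})\varphi_{\lambda_1,\dots,\lambda_{n-1}}(a_1,\dots,a_n)$. Differentials: $d_0(v+\partial A)(a)=a_{(-\partial)}v-v_{(0)}a$, and for $n\ge1$ $$d_n(\varphi)_{\lambda_1,\dots,\lambda_n}(a_1,\dots,a_{n+1})=a_1{}_{(\lambda_1)}\varphi_{\lambda_2,\dots,\lambda_n}(a_2,\dots,a_{n+1})+\sum_{i=1}^n(-1)^i\varphi_{\lambda_1,\dots,\lambda_{i-1},\lambda_i+\lambda_{i+1},\lambda_{i+2},\dots,\lambda_n}(a_1,\dots,a_{i-1},a_i{}_{(\lambda_i)}a_{i+1},a_{i+2},\dots,a_{n+1})+(-1)^{n+1}\varphi_{\lambda_1,\dots,\lambda_{n-1}}(a_1,\dots,a_n)_{(\lambda_1+\dots+\lambda_n)}a_{n+1}.$$ (In the term $i=n$, where the product is in the last argument, the subscript of $\varphi$ is $\lambda_1,\dots,\lambda_{n-1}$.) One has $d_{n+1}\circ d_n=0$; $\mathrm{HH}^n(A)=\ker d_n/\mathrm{im}\, d_{n-1}$ (with $\mathrm{HH}^0(A)=\ker d_0$); we set $\mathcal C^{-1}(A,A)=0$, $\mathrm{HH}^{-1}(A)=0$. Bracket: for $f\in\mathcal C^m(A,A)$, $g\in\mathcal C^n(A,A)$, $m,n\ge1$, $0\le i\le m-1$, define $f\bullet_ig\in\mathcal C^{m+n-1}(A,A)$ by $$(f\bullet_ig)_{\lambda_1,\dots,\lambda_{m+n-2}}(a_1,\dots,a_{m+n-1})=f_{\lambda_1,\dots,\lambda_i,\lambda_{i+1}+\dots+\lambda_{i+n},\lambda_{i+n+1},\dots,\lambda_{m+n-2}}\big(a_1,\dots,a_i,g_{\lambda_{i+1},\dots,\lambda_{i+n-1}}(a_{i+1},\dots,a_{i+n}),a_{i+n+1},\dots,a_{m+n-1}\big)$$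 (when $i=m-1$, i.e. $g$ is in the last argument, the subscript of $f$ is $\lambda_1,\dots,\lambda_{m-1}$), and $f\bullet g=\sum_{i=0}^{m-1}(-1)^{(n-1)i}f\bullet_ig$. For $b\in\mathcal C^0(A,A)$ and any $f\in\mathcal C^m(A,A)$, $m\ge 0$, put $b\bullet f=0$, and for $m\ge1$ $$(f\bullet b)_{\lambda_1,\dots,\lambda_{m-2}}(a_1,\dots,a_{m-1})=\sum_{i=1}^{m-1}(-1)^{i-1}f_{\lambda_1,\dots,\lambda_{i-1},0,\lambda_i,\dots,\lambda_{m-2}}(a_1,\dots,a_{i-1},b,a_i,\dots,a_{m-1})+(-1)^{m-1}f_{\lambda_1,\dots,\lambda_{m-2},-\partial-\lambda_1-\dots-\lambda_{m-2}}(a_1,\dots,a_{m-1},b)$$ (for $m=1$: $f\bullet b=f(b)\in A/\partial A$). Here $b$ is evaluated on any representative in $A$. Finally, $[f,g]=f\bullet g-(-1)^{(m-1)(n-1)}g\bullet f$ for $f\in\mathcal C^m(A,A)$, $g\in\mathcal C^n(A,A)$, $m,n\ge0$. *)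

(* Defs.v *)
From HB Require Import structures.
From mathcomp Require Import all_boot all_order all_algebra.
From mathcomp Require Import boolp functions.
From mathcomp Require Import finmap monalg.

Set Implicit Arguments.
Unset Strict Implicit.
Unset Printing Implicit Defensive.

Import GRing.Theory.
Local Open Scope ring_scope.
Local Open Scope quotient_scope.
(* Sealed, as conversion would otherwise unfold it down to finite maps. *)
HB.lock Definition vmonom (V : zmodType) (k : nat) (m : {cmonom 'I_k}) (v : V) :
  {malg V[{cmonom 'I_k}]} := << v *g m >>.

Lemma vmonomE (V : zmodType) k (m n : {cmonom 'I_k}) (v : V) :
  (vmonom m v)@_n = v *+ (m == n).
Proof. by rewrite vmonom.unlock mcoeffU. Qed.

Section VPoly.
Variables (C : fieldType) (V : lmodType C) (k : nat).

(* V[lambda_0, ..., lambda_(k-1)]: finitely supported families of elements of V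
   indexed by monomials.  Variables and arguments are numbered from 0. *)
Definition vpoly : Type := {malg V[{cmonom 'I_k}]}.
HB.instance Definition _ := GRing.Zmodule.on vpoly.

Definition vpoly_map (F : V -> V) (P : vpoly) : vpoly :=
  [malg m in msupp P => F P@_m].

Lemma vpoly_mapE F P m : F 0 = 0 -> (vpoly_map F P)@_m = F P@_m.
Proof. by move=> F0; rewrite mcoeffE; case: msuppP => // _; rewrite F0. Qed.

Definition vpoly_scale (c : C) : vpoly -> vpoly := vpoly_map ( *:%R c).

Lemma vpoly_scaleE c P m : (vpoly_scale c P)@_m = c *: P@_m.
Proof. by rewrite vpoly_mapE // scaler0. Qed.

Fact vpoly_scaleA a b P :
  vpoly_scale a (vpoly_scale b P) = vpoly_scale (a * b) P.
Proof. by apply/malgP => m; rewrite !vpoly_scaleE scalerA. Qed.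

Fact vpoly_scale1 : left_id 1 vpoly_scale.
Proof. by move=> P; apply/malgP => m; rewrite vpoly_scaleE scale1r. Qed.

Fact vpoly_scaleDr : right_distributive vpoly_scale +%R.
Proof.
move=> c P Q; apply/malgP => m.
by rewrite mcoeffD !vpoly_scaleE mcoeffD scalerDr.
Qed.

Fact vpoly_scaleDl P : {morph vpoly_scale^~ P : a b / a + b}.
Proof.
move=> a b; apply/malgP => m.
by rewrite mcoeffD !vpoly_scaleE scalerDl.
Qed.

HB.instance Definition _ := GRing.Zmodule_isLmodule.Build C vpoly
  vpoly_scaleA vpoly_scale1 vpoly_scaleDr vpoly_scaleDl.

Lemma mcoeffZv c (P : vpoly) m : (c *: P)@_m = c *: P@_m.
Proof. exact: vpoly_scaleE. Qed.

Definition vconst (v : V) : vpoly := vmonom mone v.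

Lemma vconstE v m : (vconst v)@_m = v *+ (mone == m :> {cmonom 'I_k}).
Proof. exact: vmonomE. Qed.

(* Multiplication by lambda_j.  The index is a natural number to spare casts;
   the value for j >= k is irrelevant. *)
Definition lam (j : nat) (P : vpoly) : vpoly :=
  if insub j is Some i
  then \sum_(m <- msupp P) vmonom (mmul (ucm (i : 'I_k)) m) P@_m else 0.

End VPoly.

Arguments vconst {C V k}.
Arguments lam {C V k}.

(* meval s F P substitutes the operators s 0, ..., s (k-1) on W for the
   variables of P, and F for its coefficients:
     sum_m lambda^m p_m  |->  sum_m s_0^(m_0) (... s_(k-1)^(m_(k-1)) (F p_m)).
   An expression in the derivation and the new variables is represented by the
   operator by which it acts; all operators used below commute. *)
Definition mact (W : Type) (k : nat) (s : nat -> W -> W) (m : {cmonom 'I_k}) :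
    W -> W :=
  \big[comp/id]_(j < k) iter (m j) (s j).

Definition meval (C : fieldType) (V W : lmodType C) (k : nat)
    (s : nat -> W -> W) (F : V -> W) (P : vpoly V k) : W :=
  \sum_(m <- msupp P) mact s m (F P@_m).

Definition msubst (C : fieldType) (V : lmodType C) (k l : nat)
    (s : nat -> vpoly V l -> vpoly V l) (P : vpoly V k) : vpoly V l :=
  meval s vconst P.

Record assocConformalAlg (C : fieldType) := AssocConformalAlg {
  ca_sort :> lmodType C;
  ca_der : {linear ca_sort -> ca_sort};
  ca_mul : ca_sort -> ca_sort -> vpoly ca_sort 1;
  ca_mul_linearl : forall b, linear (ca_mul^~ b);
  ca_mul_linearr : forall a, linear (ca_mul a);
  ca_mul_derl : forall a b, ca_mul (ca_der a) b = - lam 0 (ca_mul a b);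
  ca_mul_derr : forall a b,
    ca_mul a (ca_der b) = vpoly_map ca_der (ca_mul a b) + lam 0 (ca_mul a b);
  (* in A[lambda_0, lambda_1] *)
  ca_mulA : forall a b c : ca_sort,
    meval (fun=> lam 0)
      (fun x => msubst (fun=> lam 0 + lam 1) (ca_mul x c) : vpoly ca_sort 2)
      (ca_mul a b) =
    meval (fun=> lam 1)
      (fun x => msubst (fun=> lam 0) (ca_mul a x)) (ca_mul b c)
}.

Section Linearity.
Variables (C : fieldType).
Implicit Types (V W : lmodType C).

Lemma lin0 V W (F : V -> W) : linear F -> F 0 = 0.
Proof. by move=> h; have := h (-1) 0 0; rewrite !scaleN1r addr0 oppr0 addNr. Qed.

Lemma lin_id V : linear (@idfun V). Proof. by []. Qed.

Lemma lin_comp V W (X : lmodType C) (F : W -> X) (G : V -> W) :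
  linear F -> linear G -> linear (F \o G).
Proof. by move=> hF hG c x y /=; rewrite hG hF. Qed.

Lemma lin_iter V (F : V -> V) n : linear F -> linear (iter n F).
Proof. by move=> h; elim: n => [|n IH] c x y //=; rewrite IH h. Qed.

Lemma lin_zero V W : linear (0 : V -> W).
Proof. by move=> c x y; rewrite scaler0 addr0. Qed.

Lemma lin_add V W (F G : V -> W) : linear F -> linear G -> linear (F + G).
Proof.
by move=> hF hG c x y; rewrite !fctE hF hG scalerDr addrACA.
Qed.

Lemma lin_opp V W (F : V -> W) : linear F -> linear (- F).
Proof. by move=> h c x y; rewrite !fctE h opprD scalerN. Qed.

Lemma lin_scale V W (F : V -> W) a : linear F -> linear (fun x => a *: F x).
Proof. by move=> h c x y; rewrite h scalerDr !scalerA mulrC. Qed.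

Lemma lin_sum V W n (F : nat -> V -> W) :
  (forall i, linear (F i)) -> linear (\sum_(i < n) F i).
Proof.
move=> h; elim: n => [|n IH]; first by rewrite big_ord0; exact: lin_zero.
by rewrite big_ord_recr; exact: lin_add.
Qed.

Lemma lin_vconst V k : linear (@vconst C V k).
Proof.
move=> c x y; apply/malgP => m.
rewrite mcoeffD mcoeffZv !vconstE.
by rewrite mulrnDl scalerMnr.
Qed.

Lemma lin_mact V k (s : nat -> V -> V) (m : {cmonom 'I_k}) :
  (forall j, linear (s j)) -> linear (mact s m).
Proof.
move=> h; rewrite /mact; elim/big_rec: _ => [|j F _ hF]; first exact: lin_id.
by apply: lin_comp => //; apply: lin_iter.
Qed.

Lemma meval_wide V W k (s : nat -> W -> W) (F : V -> W)
    (D : {fset {cmonom 'I_k}}) (P : vpoly V k) :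
    (forall j, linear (s j)) -> F 0 = 0 -> (msupp P `<=` D)%fset ->
  meval s F P = \sum_(m <- D) mact s m (F P@_m).
Proof.
move=> hs hF hD; rewrite /meval [LHS](big_fset_incl _ hD) //= => m _.
by move/mcoeff_outdom => ->; rewrite hF (lin0 (lin_mact _ hs)).
Qed.

Lemma lin_meval V W k (s : nat -> W -> W) (F : V -> W) :
  (forall j, linear (s j)) -> linear F -> linear (@meval C V W k s F).
Proof.
move=> hs hF c P Q; have F0 := lin0 hF.
pose D := (msupp P `|` msupp Q `|` msupp (c *: P + Q))%fset.
rewrite !(meval_wide (D := D)) // ?fsubsetUr //; last 2 first.
- by rewrite /D -fsetUA fsubsetU // fsubsetUl orbT.
- by rewrite /D -fsetUA fsubsetUl.
rewrite scaler_sumr -big_split /=; apply: eq_bigr => m _.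
by rewrite mcoeffD mcoeffZv hF (lin_mact _ hs).
Qed.

Lemma meval_linF V W (X : lmodType C) k (s : nat -> W -> W) (F : X -> V -> W) (P : vpoly V k) :
    (forall j, linear (s j)) -> (forall v, linear (F^~ v)) ->
  linear (fun x => meval s (F x) P).
Proof.
move=> hs hF c x y; rewrite /meval scaler_sumr -big_split /=.
by apply: eq_bigr => m _; rewrite hF (lin_mact _ hs).
Qed.

Lemma lam_ord V k (i : 'I_k) (P : vpoly V k) :
  lam i P = \sum_(m <- msupp P) vmonom (mmul (ucm i) m) P@_m.
Proof. by rewrite /lam valK. Qed.

Lemma lin_lam V k j : linear (@lam C V k j).
Proof.
move=> c P Q; rewrite /lam; case: insub => [i|]; last by rewrite scaler0 addr0.
pose G (m : {cmonom 'I_k}) (v : V) : vpoly V k := vmonom (mmul (ucm i) m) v.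
have G0 m : G m 0 = 0 by rewrite /G vmonom.unlock monalgU0.
have wide (D : {fset {cmonom 'I_k}}) (R : vpoly V k) : (msupp R `<=` D)%fset ->
    \sum_(m <- msupp R) G m R@_m = \sum_(m <- D) G m R@_m.
  move=> hD; rewrite [LHS](big_fset_incl _ hD) //= => m _.
  by move/mcoeff_outdom => ->; rewrite G0.
pose D := (msupp P `|` msupp Q `|` msupp (c *: P + Q))%fset.
rewrite -!/(G _ _) !(wide D) ?fsubsetUr //; last 2 first.
- by rewrite /D -fsetUA fsubsetU // fsubsetUl orbT.
- by rewrite /D -fsetUA fsubsetUl.
rewrite scaler_sumr -big_split /=; apply: eq_bigr => m _.
apply/malgP => n; rewrite /G !(mcoeffD, mcoeffZv, vmonomE).
by rewrite mulrnDl scalerMnr.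
Qed.

Lemma lin_vpoly_map V k (F : V -> V) :
  linear F -> linear (@vpoly_map C V k F).
Proof.
move=> h c P Q; apply/malgP => m; have F0 := lin0 h.
by rewrite !(mcoeffD, mcoeffZv, vpoly_mapE) // h.
Qed.

End Linearity.

Section Quotient.
Variables (C : fieldType) (V : lmodType C) (S : submodClosed V).

Definition subm_pred : {pred V} := S.
Fact subm_zmod_closed : zmod_closed subm_pred.
Proof.
split=> [|x y Sx Sy]; first exact: rpred0.
by rewrite /subm_pred -scaleN1r; apply: rpredD => //; apply: rpredZ.
Qed.
HB.instance Definition _ :=
  GRing.isZmodClosed.Build V subm_pred subm_zmod_closed.

Definition lquot : Type := Quotient.quot subm_pred.
HB.instance Definition _ := GRing.Zmodule.on lquot.
HB.instance Definition _ := EqQuotient.on lquot.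

Definition lclass (x : V) : lquot := \pi_lquot x.

Definition lquot_scale (c : C) (u : lquot) : lquot := lclass (c *: repr u).

Lemma lclass_eq x y : (lclass x == lclass y) = (x - y \in S).
Proof. by rewrite /lclass -Quotient.idealrBE. Qed.

Lemma lclassD x y : lclass (x + y) = lclass x + lclass y.
Proof. by rewrite /lclass [LHS]pi_addr. Qed.

Lemma repr_lclass x : repr (lclass x) - x \in S.
Proof. by rewrite -lclass_eq /lclass reprK. Qed.

Lemma lquot_scaleE c x : lquot_scale c (lclass x) = lclass (c *: x).
Proof. by apply/eqP; rewrite lclass_eq -scalerBr rpredZ // repr_lclass. Qed.

Lemma lclassP u : u = lclass (repr u). Proof. by rewrite /lclass reprK. Qed.

Fact lquot_scaleA a b u :
  lquot_scale a (lquot_scale b u) = lquot_scale (a * b) u.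
Proof. by rewrite (lclassP u) !lquot_scaleE scalerA. Qed.

Fact lquot_scale1 : left_id 1 lquot_scale.
Proof. by move=> u; rewrite (lclassP u) lquot_scaleE scale1r. Qed.

Fact lquot_scaleDr : right_distributive lquot_scale +%R.
Proof.
move=> c u v; rewrite (lclassP u) (lclassP v) -lclassD !lquot_scaleE.
by rewrite scalerDr lclassD.
Qed.

Fact lquot_scaleDl u : {morph lquot_scale^~ u : a b / a + b}.
Proof.
by move=> a b; rewrite (lclassP u) !lquot_scaleE scalerDl lclassD.
Qed.

HB.instance Definition _ := GRing.Zmodule_isLmodule.Build C lquot
  lquot_scaleA lquot_scale1 lquot_scaleDr lquot_scaleDl.

Lemma lin_lclass : linear lclass.
Proof. by move=> c x y; rewrite lclassD -lquot_scaleE. Qed.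

End Quotient.

Section DirectSum.
Variables (C : fieldType) (V : nat -> lmodType C).

Record dsum := DSum {
  dval : forall n, V n;
  _ : `[< exists N, forall n, (N <= n)%N -> dval n = 0 >]
}.
HB.instance Definition _ := [isSub for dval].
HB.instance Definition _ := [Choice of dsum by <:].

Lemma dsumP (x y : dsum) : (forall n, dval x n = dval y n) -> x = y.
Proof. by move=> h; apply: val_inj; apply: functional_extensionality_dep. Qed.

Lemma dsum_bound (x : dsum) : exists N, forall n, (N <= n)%N -> dval x n = 0.
Proof. by case: x => x /= /asboolP. Qed.

Definition dsum_map2 (F : forall n, V n -> V n -> V n)
  (F0 : forall n, F n 0 0 = 0) (x y : dsum) : dsum.
Proof.
exists (fun n => F n (dval x n) (dval y n)); apply/asboolP.
have [N hN] := dsum_bound x; have [M hM] := dsum_bound y.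
by exists (maxn N M) => n; rewrite geq_max => /andP[/hN -> /hM ->].
Defined.

Definition dsum_add := dsum_map2 (F := fun n => +%R) (fun n => addr0 0).
Definition dsum_scale (c : C) (x : dsum) : dsum :=
  dsum_map2 (F := fun n a b => c *: a) (fun n => scaler0 _ c) x x.
Definition dsum_opp := dsum_scale (-1).
Definition dsum_zero : dsum.
Proof. by exists (fun n => 0); apply/asboolP; exists 0%N. Defined.

Fact dsum_addA : associative dsum_add.
Proof. by move=> x y z; apply: dsumP => n /=; rewrite addrA. Qed.
Fact dsum_addC : commutative dsum_add.
Proof. by move=> x y; apply: dsumP => n /=; rewrite addrC. Qed.
Fact dsum_add0 : left_id dsum_zero dsum_add.
Proof. by move=> x; apply: dsumP => n /=; rewrite add0r. Qed.
Fact dsum_addN : left_inverse dsum_zero dsum_opp dsum_add.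
Proof. by move=> x; apply: dsumP => n /=; rewrite scaleN1r addNr. Qed.
HB.instance Definition _ :=
  GRing.isZmodule.Build dsum dsum_addA dsum_addC dsum_add0 dsum_addN.

Fact dsum_scaleA a b x : dsum_scale a (dsum_scale b x) = dsum_scale (a * b) x.
Proof. by apply: dsumP => n /=; rewrite scalerA. Qed.
Fact dsum_scale1 : left_id 1 dsum_scale.
Proof. by move=> x; apply: dsumP => n /=; rewrite scale1r. Qed.
Fact dsum_scaleDr : right_distributive dsum_scale +%R.
Proof. by move=> c x y; apply: dsumP => n /=; rewrite scalerDr. Qed.
Fact dsum_scaleDl x : {morph dsum_scale^~ x : a b / a + b}.
Proof. by move=> a b; apply: dsumP => n /=; rewrite scalerDl. Qed.
HB.instance Definition _ := GRing.Zmodule_isLmodule.Build C dsum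
  dsum_scaleA dsum_scale1 dsum_scaleDr dsum_scaleDl.

Definition dinj (n : nat) (x : V n) : dsum.
Proof.
exists (@dfwith nat (fun i => V i : Type) (fun=> 0) n x); apply/asboolP; exists n.+1 => m lt_nm.
by rewrite dfwith_out // neq_ltn lt_nm.
Defined.

End DirectSum.

Arguments dinj {C V} n x.

Section Hochschild.
Variables (C : fieldType) (A : assocConformalAlg C).

Local Notation der := (ca_der A).
Local Notation mul := (@ca_mul C A).
Local Notation op k := (vpoly A k -> vpoly A k).

Definition pder (k : nat) : op k := vpoly_map der.

(* a_(E) b, where E is an expression acting on A[lambda_0 .. lambda_(k-1)] *)
Definition mul_at (k : nat) (E : op k) (a b : A) : vpoly A k :=
  msubst (fun=> E) (mul a b).

Lemma lin_mul_atl k (E : op k) b : linear E -> linear ((mul_at E)^~ b).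
Proof.
move=> hE c x y; rewrite /mul_at ca_mul_linearl.
by apply: lin_meval => //; exact: lin_vconst.
Qed.

Lemma lin_mul_atr k (E : op k) a : linear E -> linear (mul_at E a).
Proof.
move=> hE c x y; rewrite /mul_at ca_mul_linearr.
by apply: lin_meval => //; exact: lin_vconst.
Qed.

Definition im_der : {pred A} := fun x => `[< exists y, x = der y >].
Fact im_der_closed : submod_closed im_der.
Proof.
split=> [|c x y /asboolP[u ->] /asboolP[v ->]]; apply/asboolP.
  by exists 0; rewrite linear0.
by exists (c *: u + v); rewrite linearP.
Qed.
HB.instance Definition _ := GRing.isSubmodClosed.Build C A im_der im_der_closed.

(* All maps A^(k+1) -> A[lambda_0 .. lambda_(k-1)]; those which are
   cochains of degree k + 1 are singled out by sesquilinear below. *)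
Definition cmap (k : nat) : lmodType C := ('I_k.+1 -> A) -> vpoly A k.

Definition precochain (n : nat) : lmodType C :=
  if n is k.+1 then cmap k else lquot im_der.

Definition upd (I : eqType) (a : I -> A) (i : I) (x : A) : I -> A :=
  fun j => if j == i then x else a j.

(* Linear maps on A^(tensor k+1) are given as multilinear maps. *)
Definition sesquilinear (k : nat) (f : cmap k) : Prop :=
  [/\ forall (a : 'I_k.+1 -> A) i, linear (fun x => f (upd a i x)),
      forall (a : 'I_k.+1 -> A) (i : 'I_k.+1), (i < k)%N ->
        f (upd a i (der (a i))) = - lam i (f a)
    & forall a : 'I_k.+1 -> A,
        f (upd a ord_max (der (a ord_max))) =
        (@pder k + \sum_(j < k) lam j) (f a)].

Definition cochain (n : nat) : {pred precochain n} :=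
  match n return {pred precochain n} with
  | 0 => predT
  | k.+1 => fun f => `[< sesquilinear f >]
  end.
Arguments cochain : clear implicits.

(* (a_0, .., a_(i-1), x, a_(i+n), ..): x replaces the n arguments from a_i on;
   for n = 0 it is inserted before a_i. *)
Definition splice (K k i n : nat) (x : A) (a : 'I_K.+1 -> A) : 'I_k.+1 -> A :=
  fun j => if (j < i)%N then a (inord j)
           else if (j == i :> nat)%N then x else a (inord (j + n).-1).

(* (a_i, .., a_(i+l)) *)
Definition segment (K l i : nat) (a : 'I_K.+1 -> A) : 'I_l.+1 -> A :=
  fun j => a (inord (i + j)).

(* lambda_0, .., lambda_(i-1), lambda_i + .. + lambda_(i+n-1), lambda_(i+n), .. *)
Definition merge_vars (K i n : nat) : nat -> op K :=
  fun j => if (j < i)%N then lam j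
           else if j == i then \sum_(t < n) lam (i + t)
           else lam (j + n).-1.

Arguments merge_vars : clear implicits.

(* f bullet_i g, for f of degree k+1 and g of degree l+1.  The result has degree
   K+1 where K = k + l; leaving K free spares casts between k + l and l + k.
   For i = k the sum of variables is not used, since f depends on
   lambda_0, .., lambda_(k-1) only. *)
Definition circ_at (k l K : nat) (f : cmap k) (g : cmap l) (i : nat) : cmap K :=
  fun a => meval (fun j => lam (i + j))
    (fun x => msubst (merge_vars K i l.+1) (f (splice i l.+1 x a)))
    (g (segment i a)).

Arguments circ_at {k l} K f g i.

Definition circ (k l K : nat) (f : cmap k) (g : cmap l) : cmap K :=
  \sum_(i < k.+1) (-1) ^+ (l * i) *: circ_at K f g i.

Arguments circ {k l} K f g.

(* f bullet b, for f of degree k+2 and b in A *)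
Definition circ_elt (k K : nat) (f : cmap k.+1) (b : A) : cmap K :=
  fun a =>
    \sum_(i < k.+1) (-1) ^+ i *:
      msubst (merge_vars K i 0) (f (splice i 0 b a))
    + (-1) ^+ k.+1 *:
      msubst (fun j => if (j < k)%N then lam j
                       else - @pder K - \sum_(t < k) lam t)
        (f (splice k.+1 0 b a)).

Arguments circ_elt {k} K f b.

(* f bullet b, for f of degree 1: A[no variable] is identified with A *)
Definition circ_elt1 (f : cmap 0) (b : A) : lquot im_der :=
  lclass _ (f (fun=> b))@_mone.

(* Only the case r = m + n - 1 is meaningful, or m = n = 0, where the bracket
   vanishes and r is irrelevant. *)
Definition bullet (m n r : nat) :
    precochain m -> precochain n -> precochain r :=
  match m, n, r
  return precochain m -> precochain n -> precochain r with
  | k.+1, l.+1, K.+1 => fun f g => circ K f g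
  | 1, 0, 0 => fun f b => circ_elt1 f (repr b)
  | k.+2, 0, K.+1 => fun f b => circ_elt K f (repr b)
  | _, _, _ => fun _ _ => 0
  end.

Arguments bullet {m n} r f g.

(* (-1)^((m-1)(n-1)); the exponent is replaced by one of the same parity that
   does not become negative for m = 0 or n = 0. *)
Definition bsign (m n : nat) : C := (-1) ^+ (m.+1 * n.+1).

(* C^m x C^n -> C^(m+n-1).  For m = n = 0 the target C^(-1) = 0 is replaced by
   C^0, with value 0. *)
Definition bracket (m n : nat) (f : precochain m) (g : precochain n) :
    precochain (m + n).-1 :=
  bullet (m + n).-1 f g - bsign m n *: bullet (m + n).-1 g f.

Definition mulc : cmap 1 := fun a => mul (a ord0) (a ord_max).

Definition diff0 (v : lquot im_der) : cmap 0 := fun a =>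
  mul_at (- @pder 0) (a ord0) (repr v) - mul_at 0 (repr v) (a ord0).

(* The first and last terms of the differential of f are the compositions
   a_1 (lambda_1) f(a_2, ..) and f(a_1, ..) (lambda_1 + .. + lambda_n) a_(n+1)
   of the product with f. *)
Definition diffS (k : nat) (f : cmap k) : cmap k.+1 :=
  circ_at k.+1 mulc f 1
  + \sum_(i < k.+1) (-1) ^+ i.+1 *: circ_at k.+1 f mulc i
  + (-1) ^+ k.+2 *: circ_at k.+1 mulc f 0.

Definition diff (n : nat) : precochain n -> precochain n.+1 :=
  match n return precochain n -> precochain n.+1 with
  | 0 => diff0
  | k.+1 => @diffS k
  end.

Lemma lin_pder k : linear (@pder k).
Proof. by apply: lin_vpoly_map => c x y; rewrite linearP. Qed.

Lemma lin_merge_vars K i n j : linear (merge_vars K i n j).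
Proof.
rewrite /merge_vars; case: ifP => _; first exact: lin_lam.
case: ifP => _; last exact: lin_lam.
by apply: (@lin_sum _ _ _ n (fun t => lam (i + t))) => t; exact: lin_lam.
Qed.

Lemma lin_pder_lam k : linear (@pder k + \sum_(j < k) lam j).
Proof.
apply: lin_add; first exact: lin_pder.
by apply: (@lin_sum _ _ _ k lam) => j; exact: lin_lam.
Qed.

Lemma lin_msubst k l (s : nat -> op l) :
  (forall j, linear (s j)) -> linear (@msubst C A k l s).
Proof. by move=> hs; apply: lin_meval => //; exact: lin_vconst. Qed.

Lemma circ_at_linearl k l K (g : cmap l) i :
  linear (fun f : cmap k => circ_at K f g i).
Proof.
move=> c f h; apply/funext => a; rewrite /circ_at !fctE.
apply: (@meval_linF _ _ _ (cmap k) _ _ (fun f x =>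
  msubst (merge_vars K i l.+1) (f (splice i l.+1 x a)))) => [j|x d p q].
  exact: lin_lam.
by rewrite !fctE (lin_msubst (lin_merge_vars _ _)).
Qed.

Lemma circ_at_mulc_linear l K (i : bool) :
  linear (fun g : cmap l => circ_at K mulc g i).
Proof.
move=> c f h; apply/funext => a; rewrite /circ_at !fctE.
apply: lin_meval => [j|d x y]; first exact: lin_lam.
rewrite /mulc /splice /=; case: i => /=.
  by rewrite ca_mul_linearr; apply: lin_msubst; exact: lin_merge_vars.
by rewrite ca_mul_linearl; apply: lin_msubst; exact: lin_merge_vars.
Qed.

Lemma diffS_linear k : linear (@diffS k).
Proof.
move=> c f h; rewrite /diffS (circ_at_mulc_linear _ true).
rewrite (circ_at_mulc_linear _ false) !scalerDr !scalerA.
rewrite (eq_bigr (fun i : 'I_k.+1 =>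
    c *: ((-1) ^+ i.+1 *: circ_at k.+1 f mulc i)
    + (-1) ^+ i.+1 *: circ_at k.+1 h mulc i)); last first.
  move=> i _; rewrite [circ_at _ (c *: f + h) _ _]circ_at_linearl.
  by rewrite scalerDr !scalerA mulrC.
rewrite big_split /= -scaler_sumr [_ * c]mulrC.
by rewrite [X in X + _ = _]addrACA [LHS]addrACA.
Qed.

Lemma mact1 (W : Type) (s : nat -> W -> W) (m : {cmonom 'I_1}) :
  mact s m = iter (m ord0) (s 0%N).
Proof. by rewrite /mact big_ord_recl big_ord0. Qed.

Lemma msubst_lam k (E : op k) (P : vpoly A 1) : linear E ->
  msubst (fun=> E) (lam 0 P) = E (msubst (fun=> E) P).
Proof.
move=> hE; rewrite -[0%N]/(nat_of_ord (ord0 : 'I_1)) lam_ord /msubst.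
have hs : forall j : nat, linear ((fun=> E) j : op k) by [].
have h := lin_meval (k := 1) hs (@lin_vconst C A k).
have E0 := lin0 hE; have h0 := lin0 h.
have -> : meval (fun=> E) vconst
    (\sum_(m <- msupp P) vmonom (mmul (ucm ord0) m) P@_m) =
    \sum_(m <- msupp P) meval (fun=> E) vconst
       (vmonom (mmul (ucm ord0) m) P@_m : vpoly A 1).
  apply: (big_morph _ _ h0) => x y.
  by have := h 1 x y; rewrite !scale1r.
rewrite /meval (big_morph E (id1 := 0) (op1 := +%R)) //; last first.
  by move=> x y; have := hE 1 x y; rewrite !scale1r.
apply: eq_bigr => m _; rewrite -/(meval _ _ _).
rewrite (meval_wide (D := [fset mmul (ucm ord0) m]%fset)) //.
- rewrite big_seq_fset1 vmonomE eqxx mulr1n !mact1.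
  by rewrite mulcmE ucmE.
- exact: (lin0 (@lin_vconst C A k)).
- by rewrite vmonom.unlock msuppU_le.
Qed.

Lemma pder_vconst k (v : A) : @pder k (vconst v) = vconst (der v).
Proof.
apply/malgP => m; rewrite vpoly_mapE ?linear0 // !vconstE.
by rewrite raddfMn.
Qed.

Lemma msubst_map k (E : op k) (P : vpoly A 1) :
  linear E -> (forall Q, E (pder Q) = pder (E Q)) ->
  msubst (fun=> E) (vpoly_map der P) = pder (msubst (fun=> E) P).
Proof.
move=> hE hc; rewrite /msubst.
have v0 := lin0 (@lin_vconst C A k).
have sub : (msupp (vpoly_map der P) `<=` msupp P)%fset.
  apply/fsubsetP => m; rewrite -!mcoeff_neq0 vpoly_mapE ?linear0 //.
  by apply: contra => /eqP ->; rewrite linear0.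
rewrite (meval_wide _ v0 sub) // /meval.
rewrite (big_morph (@pder k) (id1 := 0) (op1 := +%R)); first last.
- exact: (lin0 (@lin_pder k)).
- by move=> x y; have := @lin_pder k 1 x y; rewrite !scale1r.
apply: eq_bigr => m _; rewrite vpoly_mapE ?linear0 // -pder_vconst !mact1.
by elim: (m ord0) => //= n ->.
Qed.

Lemma mul_at_derl k (E : op k) a b : linear E ->
  mul_at E (der a) b = - E (mul_at E a b).
Proof.
move=> hE; rewrite /mul_at ca_mul_derl -msubst_lam // -[in LHS]scaleN1r.
have := lin_msubst (k := 1) (fun=> hE) (-1) (lam 0 (mul a b)) 0.
by rewrite !addr0 => ->; rewrite (lin0 (lin_msubst (fun=> hE))) addr0 scaleN1r.
Qed.

Lemma mul_at_derr k (E : op k) a b :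
  linear E -> (forall Q, E (pder Q) = pder (E Q)) ->
  mul_at E a (der b) = pder (mul_at E a b) + E (mul_at E a b).
Proof.
move=> hE hc; rewrite /mul_at ca_mul_derr -msubst_lam // -msubst_map //.
have := lin_msubst (k := 1) (fun=> hE) 1 (vpoly_map der (mul a b))
  (lam 0 (mul a b)).
by rewrite !scale1r.
Qed.

Lemma diff0_lclass v : diff0 (lclass _ v) =
  fun a => mul_at (- @pder 0) (a ord0) v - mul_at 0 v (a ord0).
Proof.
apply/funext => a; rewrite /diff0.
have /asboolP[y hy] := repr_lclass im_der v.
have -> : repr (lclass im_der v) = v + der y by rewrite -hy addrC subrK.
have hN : linear (- @pder 0 : op 0) by apply: lin_opp; exact: lin_pder.
have opE Q : (- @pder 0) Q = - pder Q by [].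
have hZ : linear (0 : op 0) by exact: lin_zero.
have eqr : mul_at (- @pder 0) (a ord0) (v + der y) =
    mul_at (- @pder 0) (a ord0) v.
  have := lin_mul_atr (a ord0) hN 1 v (der y); rewrite !scale1r => ->.
  rewrite mul_at_derr //; first by rewrite opE subrr addr0.
  move=> Q; rewrite !opE; have := @lin_pder 0 (-1) (pder Q) 0.
  by rewrite addr0 (lin0 (@lin_pder 0)) addr0 !scaleN1r => ->.
have eql : mul_at 0 (v + der y) (a ord0) = mul_at (0 : op 0) v (a ord0).
  have := lin_mul_atl (a ord0) hZ 1 v (der y); rewrite !scale1r => ->.
  by rewrite mul_at_derl // oppr0 addr0.
by rewrite eqr eql.
Qed.

Lemma diff0_linear : linear diff0.
Proof.
move=> c u v; rewrite (lclassP u) (lclassP v).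
rewrite -(lin_lclass im_der) !diff0_lclass; apply/funext => a.
rewrite !fctE.
rewrite lin_mul_atr; last by apply: lin_opp; exact: lin_pder.
rewrite lin_mul_atl; last exact: lin_zero.
by rewrite opprD addrACA scalerBr.
Qed.

Lemma diff_linear n : linear (@diff n).
Proof. by case: n => [|k]; [exact: diff0_linear | exact: diffS_linear]. Qed.

Lemma sesquilinear_comb k c (f g : cmap k) :
  sesquilinear f -> sesquilinear g -> sesquilinear (c *: f + g).
Proof.
move=> [f1 f2 f3] [g1 g2 g3]; split.
- move=> a i; rewrite [fun x => _](_ : _ = (fun x => c *: f (upd a i x)) +
    (fun x => g (upd a i x))) //.
  by apply: lin_add => //; apply: lin_scale.
- by move=> a i lt_ik; rewrite !fctE f2 // g2 // lin_lam opprD scalerN.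
- move=> a; rewrite !fctE f3 g3.
  exact/esym/lin_pder_lam.
Qed.

Lemma sesquilinear0 k : sesquilinear (0 : cmap k).
Proof.
have E a : (0 : cmap k) a = 0 by [].
split=> [a i c x y|a i _|a]; rewrite !E.
- by rewrite scaler0 addr0.
- by rewrite (lin0 (@lin_lam C A k i)) oppr0.
- exact/esym/(lin0 (@lin_pder_lam k)).
Qed.

Fact cochain_closed n : submod_closed (cochain n).
Proof.
case: n => [|k]; first by split.
split=> [|c f g /asboolP hf /asboolP hg]; apply/asboolP.
  exact: sesquilinear0.
exact: sesquilinear_comb.
Qed.
HB.instance Definition _ n :=
  GRing.isSubmodClosed.Build C (precochain n) (cochain n) (@cochain_closed n).

Definition cocycle (n : nat) : {pred precochain n} :=
  fun f => (f \in cochain n) && (diff f == 0).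
Arguments cocycle : clear implicits.

Fact cocycle_closed n : submod_closed (cocycle n).
Proof.
split=> [|c f g /andP[hf /eqP df] /andP[hg /eqP dg]]; apply/andP; split.
- exact: rpred0.
- by rewrite (lin0 (@diff_linear n)).
- by apply: rpredD => //; apply: rpredZ.
- by rewrite diff_linear df dg scaler0 addr0.
Qed.
HB.instance Definition _ n :=
  GRing.isSubmodClosed.Build C (precochain n) (cocycle n) (@cocycle_closed n).
HB.instance Definition _ n :=
  GRing.isZmodClosed.Build (precochain n) (cocycle n)
    (subm_zmod_closed (cocycle n)).

Record Zcocycle (n : nat) : Type := ZCocycle {
  zval :> precochain n;
  _ : zval \in cocycle n
}.
HB.instance Definition _ n := [isSub for @zval n].
HB.instance Definition _ n := [Choice of Zcocycle n by <:].
HB.instance Definition _ n := [SubChoice_isSubZmodule of Zcocycle n by <:].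
HB.instance Definition _ n := [SubZmodule_isSubLmodule of Zcocycle n by <:].

(* For n = 0 there are none, as C^(-1) = 0. *)
Definition coboundary (n : nat) : {pred Zcocycle n} :=
  match n return {pred Zcocycle n} with
  | 0 => pred1 0
  | p.+1 => fun z => `[< exists2 g, g \in cochain p & zval z = diff g >]
  end.

Arguments coboundary : clear implicits.

Fact coboundary_closed n : submod_closed (coboundary n).
Proof.
case: n => [|p].
  split=> [|c x y /eqP -> /eqP ->]; apply/eqP => //.
  by rewrite scaler0 addr0.
split=> [|c x y /asboolP[f hf xf] /asboolP[g hg yg]]; apply/asboolP.
  by exists 0; rewrite ?rpred0 // (lin0 (@diff_linear p)).
exists (c *: f + g); first by apply: rpredD => //; apply: rpredZ.
by rewrite diff_linear -xf -yg.
Qed.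
HB.instance Definition _ n :=
  GRing.isSubmodClosed.Build C (Zcocycle n) (coboundary n)
    (@coboundary_closed n).

Definition HH (n : nat) : lmodType C := lquot (coboundary n).

Definition HHclass (n : nat) (z : Zcocycle n) : HH n :=
  lclass (coboundary n) z.

Definition HHtot : lmodType C := dsum HH.

End Hochschild.

Arguments cochain {C} A n _.
Arguments cocycle {C} A n _.
Arguments coboundary {C} A n _.
Arguments merge_vars {C} A K i n.
Arguments circ_at {C A k l} K f g i.
Arguments circ {C A k l} K f g.
Arguments circ_elt {C A k} K f b.
Arguments bullet {C A m n} r f g.

(* Main.v *)
(* A cochain f of degree n is studied through all its evaluations: given a vector
   space W with commuting operators E_0, .., E_(n-1) and ev : A -> W such that
   ev (der a) = - (E_0 + .. + E_(n-1)) (ev a), substitute E_j for lambda_j and ev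
   for the coefficients of f (a_0, .., a_(n-1)).  Although f only involves the
   first n - 1 variables, sesquilinearity then becomes symmetric: a derivation in
   slot i acts as - E_i, the last slot included.  Degree 0 fits in, with ev
   vanishing on the image of der, and evaluations separate cochains.  In these
   terms every f bullet_i g is plain substitution of g into f, E_i being replaced
   by the sum of the operators of g, also when g has degree 0 or sits in the last
   slot; so the axioms of a nonsymmetric operad hold, where the parallel one is
   the exchange of two finite sums.  They make bullet a graded right pre-Lie
   product, whence the Jacobi identity for cochains.  As diff f is
   (-1)^(n-1) [mulc, f], Jacobi also shows that diff is a derivation of the
   bracket, which therefore descends to cohomology. *)

Require Import Defs.
From mathcomp Require Import all_boot all_order all_algebra.
From mathcomp Require Import boolp functions finmap monalg.
From mathcomp Require Import zify ring.

Set Implicit Arguments.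
Unset Strict Implicit.
Unset Printing Implicit Defensive.

Import GRing.Theory.
Local Open Scope ring_scope.

(** * Substitution of operators into vector-valued polynomials *)

Section Evaluation.
Variable C : fieldType.
Implicit Types V W X : lmodType C.

Lemma linD V W (F : V -> W) x y : linear F -> F (x + y) = F x + F y.
Proof. by move=> h; have := h 1 x y; rewrite !scale1r. Qed.

Lemma linZ V W (F : V -> W) c x : linear F -> F (c *: x) = c *: F x.
Proof. by move=> h; have := h c x 0; rewrite !addr0 (lin0 h) addr0. Qed.

Lemma linN V W (F : V -> W) x : linear F -> F (- x) = - F x.
Proof. by move=> h; rewrite -!scaleN1r linZ. Qed.

Lemma linsum V W (F : V -> W) (I : Type) (r : seq I) (P : pred I) (E : I -> V) :
  linear F -> F (\sum_(i <- r | P i) E i) = \sum_(i <- r | P i) F (E i).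
Proof.
by move=> h; apply: (big_morph F) => [x y|]; [apply: linD | apply: lin0].
Qed.

Lemma mact_morph W X k (s : nat -> W -> W) (s' : nat -> X -> X) (T : W -> X)
    (m : {cmonom 'I_k}) w :
  (forall (j : 'I_k) u, T (s j u) = s' j (T u)) ->
  T (mact s m w) = mact s' m (T w).
Proof.
move=> h; rewrite /mact; elim: (index_enum _) w => [|j r IH] w.
  by rewrite !big_nil.
rewrite !big_cons /=; elim: (m j) => [|n IHn] /=; first exact: IH.
by rewrite h IHn.
Qed.

Lemma eq_mact W k (s s' : nat -> W -> W) (m : {cmonom 'I_k}) :
  (forall j, (j < k)%N -> s j = s' j) -> mact s m = mact s' m.
Proof. by move=> h; apply: eq_bigr => j _; rewrite h. Qed.

Lemma mact_mone W k (s : nat -> W -> W) : mact s (mone : {cmonom 'I_k}) = id.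
Proof.
rewrite /mact; elim: (index_enum _) => [|j r IH]; first by rewrite big_nil.
by rewrite big_cons IH cm1 /=.
Qed.

(** [mact] composes the powers in the fixed order of the index enumeration; commutation brings the
    extra factor [s i] to the front. *)
Lemma mact_mulU W k (s : nat -> W -> W) (m : {cmonom 'I_k}) (i : 'I_k) w :
  (forall a b u, s a (s b u) = s b (s a u)) ->
  mact s (mmul (ucm i) m) w = s i (mact s m w).
Proof.
move=> h; rewrite /mact.
have: i \in index_enum 'I_k by rewrite mem_index_enum.
elim: (index_enum _) (index_enum_uniq 'I_k) => //= j r IH /andP[jr ur].
have h' n a b u : s a (iter n (s b) u) = iter n (s b) (s a u).
  by elim: n => //= n IHn; rewrite h IHn.
rewrite !big_cons inE /= cmM cmU; case: (eqVneq i j) => [ij _|ne ir].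
  subst j; rewrite ?eqxx /= add0n; congr (s i (iter _ _ (_ w))).
  apply: eq_big_seq => t tr; rewrite cmM cmU.
  by case: eqP => // e; rewrite e tr in jr.
by rewrite /= add0n IH // h'.
Qed.

Lemma meval_vmonom V W k (s : nat -> W -> W) (F : V -> W) (m : {cmonom 'I_k}) v :
  (forall j, linear (s j)) -> linear F ->
  meval s F (vmonom m v : vpoly V k) = mact s m (F v).
Proof.
move=> hs hF; rewrite (meval_wide (D := [fset m]%fset)) ?(lin0 hF) //.
  by rewrite big_seq_fset1 vmonomE eqxx mulr1n.
by rewrite vmonom.unlock msuppU_le.
Qed.

Lemma meval_vconst V W k (s : nat -> W -> W) (F : V -> W) v :
  (forall j, linear (s j)) -> linear F ->
  meval s F (vconst v : vpoly V k) = F v.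
Proof. by move=> hs hF; rewrite meval_vmonom // mact_mone. Qed.

Lemma vpolyE V k (P : vpoly V k) :
  P = \sum_(m <- msupp P) vmonom m P@_m.
Proof.
rewrite {1}[P]monalgE; apply: eq_bigr => m _; by rewrite vmonom.unlock.
Qed.

Lemma lin_vmonom V k (m : {cmonom 'I_k}) :
  linear (vmonom m : V -> vpoly V k).
Proof.
move=> c x y; apply/malgP => n.
by rewrite mcoeffD mcoeffZv !vmonomE mulrnDl scalerMnr.
Qed.

Lemma lam_vmonom V k (i : 'I_k) (m : {cmonom 'I_k}) (v : V) :
  lam i (vmonom m v : vpoly V k) = vmonom (mmul (ucm i) m) v.
Proof.
rewrite lam_ord; have [->|nz] := eqVneq v 0.
  by rewrite !(lin0 (lin_vmonom _)) msupp0 big_nil.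
have -> : msupp (vmonom m v : vpoly V k) = [fset m]%fset.
  by rewrite vmonom.unlock msuppU (negbTE nz).
by rewrite big_seq_fset1 vmonomE eqxx mulr1n.
Qed.

Lemma lam_out V k j (P : vpoly V k) : (k <= j)%N -> lam j P = 0.
Proof. by move=> h; rewrite /lam insubF // ltnNge h. Qed.

Lemma meval_lam V W k (s : nat -> W -> W) (F : V -> W) j (P : vpoly V k) :
    (forall j, linear (s j)) -> (forall a b u, s a (s b u) = s b (s a u)) ->
    linear F -> (j < k)%N ->
  meval s F (lam j P) = s j (meval s F P).
Proof.
move=> hs hc hF lt_jk; rewrite [P]vpolyE.
rewrite (linsum _ _ _ (@lin_lam _ _ _ j)) !(linsum _ _ _ (lin_meval hs hF)).
rewrite (linsum _ _ _ (hs j)); apply: eq_bigr => m _.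
rewrite -[j]/(nat_of_ord (Ordinal lt_jk)) lam_vmonom.
by rewrite !meval_vmonom // mact_mulU.
Qed.

(** Main tool for nested substitutions: when [T] is itself an evaluation, each operator on
    polynomials turns into the operator on values that [T] intertwines with it. *)
Lemma meval_morph V W X k (s : nat -> W -> W) (s' : nat -> X -> X) (T : W -> X)
    (F : V -> W) (P : vpoly V k) : linear T ->
  (forall j u, (j < k)%N -> T (s j u) = s' j (T u)) ->
  T (meval s F P) = meval s' (T \o F) P.
Proof.
move=> hT h; rewrite /meval (linsum _ _ _ hT); apply: eq_bigr => m _.
by rewrite (mact_morph (s' := s')) // => j u; apply: h.
Qed.

Lemma eq_meval V W k (s s' : nat -> W -> W) (F F' : V -> W) (P : vpoly V k) :
  (forall j, (j < k)%N -> s j = s' j) -> F =1 F' -> meval s F P = meval s' F' P.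
Proof.
by move=> hs hF; apply: eq_bigr => m _; rewrite (eq_mact _ hs) hF.
Qed.

Lemma vpoly_map_vmonom V k (d : V -> V) (m : {cmonom 'I_k}) (v : V) :
  linear d -> vpoly_map d (vmonom m v : vpoly V k) = vmonom m (d v).
Proof.
move=> hd; apply/malgP => n; rewrite vpoly_mapE ?lin0 // !vmonomE.
by case: eqP => _; rewrite ?mulr1n // !mulr0n lin0.
Qed.

Lemma meval_map V W k (s : nat -> W -> W) (F : V -> W) (d : V -> V) (P : vpoly V k) :
  (forall j, linear (s j)) -> linear F -> linear d ->
  meval s F (vpoly_map d P) = meval s (F \o d) P.
Proof.
move=> hs hF hd; have hFd := lin_comp hF hd.
rewrite [P]vpolyE (linsum _ _ _ (lin_vpoly_map hd)).
rewrite !(linsum _ _ _ (lin_meval hs _)) //; apply: eq_bigr => m _.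
rewrite meval_vmonom //=.
by rewrite vpoly_map_vmonom // meval_vmonom.
Qed.

(** Both sides are the double sum over the monomials of [P] and of [Q]; this exchange is the source
    of the parallel operad axiom. *)
Lemma meval_exchange V V' W k l (s s' : nat -> W -> W) (B : V -> V' -> W)
    (P : vpoly V k) (Q : vpoly V' l) :
    (forall j, linear (s j)) -> (forall j, linear (s' j)) ->
    (forall i j u, s i (s' j u) = s' j (s i u)) ->
  meval s (fun x => meval s' (B x) Q) P = meval s' (fun y => meval s (B^~ y) P) Q.
Proof.
move=> hs hs' hc; rewrite {1}/meval.
under eq_bigr => m _ do rewrite {1}/meval (linsum _ _ _ (lin_mact m hs)).
rewrite exchange_big /=; apply: eq_bigr => n _.
rewrite /meval (linsum _ _ _ (lin_mact n hs')); apply: eq_bigr => m _.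
apply: mact_morph => j u; symmetry.
by apply: mact_morph => i v; rewrite hc.
Qed.

Lemma mact_lam V k (m n : {cmonom 'I_k}) (v : V) :
  mact (@lam C V k) m (vmonom n v) = vmonom (mmul m n) v.
Proof.
(* For the induction over the enumeration, the exponents of [m] count only at indices of the list
   treated so far. *)
suff [n' -> h] : exists2 n', mact (@lam C V k) m (vmonom n v) = vmonom n' v &
    forall i, n' i = ((if i \in index_enum 'I_k then m i else 0) + n i)%N.
  congr vmonom; apply/eqP/cmP => i.
  by rewrite h mem_index_enum cmM.
rewrite /mact; elim: (index_enum _) (index_enum_uniq 'I_k) => [_|j r IH] /=.
  by exists n => //; rewrite big_nil.
case/andP=> jr /IH[n' e h]; rewrite big_cons /= e.
exists (iter (m j) (mmul (ucm j)) n').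
  by elim: (m j) => //= t ->; rewrite lam_vmonom.
move=> i.
have -> t : iter t (mmul (ucm j)) n' i = (t * (j == i) + n' i)%N.
  by elim: t => [|t IHt] /=; rewrite ?add0n // cmM cmU IHt mulSn addnA.
rewrite h inE; case: (eqVneq i j) => [->|ne] /=.
  by rewrite ?eqxx (negbTE jr) muln1.
by rewrite muln0.
Qed.

Lemma meval_vpoly V k (P : vpoly V k) : meval (@lam C V k) vconst P = P.
Proof.
rewrite {2}[P]vpolyE; apply: eq_bigr => m _.
by rewrite mact_lam mulm1.
Qed.

Lemma lamC V k i j (P : vpoly V k) : lam i (lam j P) = lam j (lam i P).
Proof.
case: (ltnP i k) => [hi|hi]; last first.
  by rewrite !(lam_out _ hi) (lin0 (@lin_lam _ _ _ j)).
case: (ltnP j k) => [hj|hj]; last first.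
  by rewrite !(lam_out _ hj) (lin0 (@lin_lam _ _ _ i)).
rewrite [P]vpolyE !(linsum _ _ _ (@lin_lam _ _ _ _)).
apply: eq_bigr => m _.
rewrite -[i]/(nat_of_ord (Ordinal hi)) -[j]/(nat_of_ord (Ordinal hj)).
by rewrite !lam_vmonom !mulmA [mmul (ucm (Ordinal hi)) (ucm _)]mulmC.
Qed.

Lemma vpoly_map_lam V k (d : V -> V) i (P : vpoly V k) :
  linear d -> vpoly_map d (lam i P) = lam i (vpoly_map d P).
Proof.
move=> hd; case: (ltnP i k) => [hi|hi]; last first.
  by rewrite !(lam_out _ hi) (lin0 (@lin_vpoly_map _ _ _ _ hd)).
have hm := @lin_vpoly_map C V k d hd.
rewrite [P]vpolyE !(linsum _ _ _ (@lin_lam _ _ _ _), linsum _ _ _ hm).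
apply: eq_bigr => m _.
rewrite -[i]/(nat_of_ord (Ordinal hi)).
by rewrite !(lam_vmonom, vpoly_map_vmonom).
Qed.
End Evaluation.

(** * Substitution maps form an operad *)

Section Operad.
Variables (C : fieldType) (T : Type) (W : lmodType C).

(* An argument a_j together with the operator substituted for lambda_j. *)
Definition input : Type := (T * (W -> W))%type.
Definition evalmap : Type := (nat -> input) -> (T -> W) -> W.

Definition shift (i : nat) (x : nat -> input) : nat -> input :=
  fun j => x (i + j)%N.

Definition weight (i n : nat) (x : nat -> input) : W -> W :=
  fun w => \sum_(i <= t < i + n) (x t).2 w.

(** The inputs seen by an outer map whose slot [i] receives a result of degree [n]. For [n = 0]
    nothing is merged: an element with the zero operator is added and the later inputs move up by
    one. *)
Definition insert (i n : nat) (x : nat -> input) (y : T) : nat -> input :=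
  fun j => if (j < i)%N then x j
           else if (j == i)%N then (y, weight i n x) else x (j + n).-1.

(** Substitution without polynomials: the coefficients of [g] are the elements inserted in [f], so
    [f] becomes the coefficient map at which [g] is evaluated. *)
Definition comp_at (n i : nat) (f g : evalmap) : evalmap :=
  fun x ev => g (shift i x) (fun y => f (insert i n x y) ev).

(* n.+1 has the parity of n - 1, and does not truncate at n = 0. *)
Definition ecomp (m n : nat) (f g : evalmap) : evalmap :=
  fun x ev => \sum_(i < m) (-1) ^+ (n.+1 * i) *: comp_at n i f g x ev.

Definition linear_ops (x : nat -> input) := forall j, linear (x j).2.
Definition commuting (x : nat -> input) :=
  forall i j w, (x i).2 ((x j).2 w) = (x j).2 ((x i).2 w).

(** What the parallel axiom asks of two evaluations; for cochains it is the exchange of two finite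
    sums. *)
Definition exchanges (f g : evalmap) :=
  forall x x' (B : T -> T -> W), linear_ops x -> linear_ops x' ->
    (forall i j w, (x i).2 ((x' j).2 w) = (x' j).2 ((x i).2 w)) ->
  f x (fun y => g x' (B y)) = g x' (fun z => f x (B^~ z)).

Definition local (n : nat) (f : evalmap) :=
  forall x x' ev, (forall j, (j < n)%N -> x j = x' j) -> f x ev = f x' ev.

Definition ev_linear (f : evalmap) :=
  forall x k (c : 'I_k -> C) (ev : 'I_k -> T -> W), linear_ops x ->
  f x (fun y => \sum_i c i *: ev i y) = \sum_i c i *: f x (ev i).

Lemma linear_ops_shift i x : linear_ops x -> linear_ops (shift i x).
Proof. by move=> h j; apply: h. Qed.

Lemma commuting_shift i x : commuting x -> commuting (shift i x).
Proof. by move=> h j k w; apply: h. Qed.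

Lemma weight_linear i n x : linear_ops x -> linear (weight i n x).
Proof.
move=> h c u v; rewrite /weight scaler_sumr -big_split /=.
by apply: eq_bigr => t _; rewrite h.
Qed.

Lemma commuting_weight i n j x w : linear_ops x -> commuting x ->
  (x j).2 (weight i n x w) = weight i n x ((x j).2 w).
Proof.
by move=> l h; rewrite /weight (linsum _ _ _ (l j)); apply: eq_bigr => t _; rewrite h.
Qed.

Lemma linear_ops_insert i n x y : linear_ops x -> linear_ops (insert i n x y).
Proof.
move=> h j; rewrite /insert; case: ifP => _; first exact: h.
case: ifP => _; last exact: h.
exact: weight_linear.
Qed.

Lemma commuting_insert i n x y : linear_ops x -> commuting x ->
  commuting (insert i n x y).
Proof.
move=> l h j k w; rewrite /insert.
case: ifP => _; last case: ifP => _; (case: ifP => _; last case: ifP => _) => //=;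
  by rewrite ?commuting_weight.
Qed.

(** * Insertions against shifts, sums of operators and other insertions *)

Lemma insert_shift i j p x y :
  shift i (insert (i + j) p x y) = insert j p (shift i x) y.
Proof.
apply/funext => t; rewrite /shift /insert ltn_add2l eqn_add2l.
case: ltnP => // le_jt; case: eqVneq => [_|ne].
  congr (_, _); apply/funext => w; rewrite /weight -addnA.
  rewrite -[in LHS](addnC j) -[in LHS](addnC (j + p)) big_addn addnK.
  by apply: eq_bigr => u _; rewrite addnC.
by congr x; lia.
Qed.

(** Reindexing along [t + p - 1]; [0 < a] keeps the truncated predecessor faithful when [p = 0]. *)
Lemma big_nat_shift_pred (V : nmodType) a b p (F : nat -> V) : (0 < a)%N ->
  \sum_(a <= t < b) F (t + p).-1 = \sum_((a + p).-1 <= t < (b + p).-1) F t.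
Proof.
case: a => // a _; rewrite big_add1 addSn /= big_addn.
have -> : ((b + p).-1 - p = b.-1 - (p - p))%N by lia.
by rewrite subnn subn0; apply: eq_bigr.
Qed.

Lemma big_nat_split (V : nmodType) b a c (F : nat -> V) : (a <= b <= c)%N ->
  \sum_(a <= t < c) F t = \sum_(a <= t < b) F t + \sum_(b <= t < c) F t.
Proof. by case/andP=> ab bc; rewrite (big_cat_nat ab bc). Qed.

(** The operator inserted at [j] is itself a sum of [p] operators, so the block regains its
    [n + p - 1] original ones. *)
Lemma weight_insert_in i n j p x y : (i <= j < i + n)%N ->
  weight i n (insert j p x y) = weight i (n + p).-1 x.
Proof.
case/andP=> le_ij lt_jn; apply/funext => w; rewrite /weight.
rewrite (@big_nat_split _ j) ?(big_ltn lt_jn); last by rewrite le_ij ltnW.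
rewrite [RHS](@big_nat_split _ j); last by lia.
rewrite [X in _ = _ + X](@big_nat_split _ (j + p)); last by lia.
congr (_ + (_ + _)).
- by apply: eq_big_nat => t /andP[_ lt]; rewrite /insert lt.
- by rewrite /insert ltnn eqxx.
have -> : (i + (n + p).-1 = (i + n + p).-1)%N by lia.
rewrite -[(j + p)%N]/(j.+1 + p).-1 -(big_nat_shift_pred _ _ (fun t => (x t).2 w)) //.
apply: eq_big_nat => t /andP[lt _].
by rewrite /insert ltnNge ltnW //= gtn_eqF.
Qed.

Lemma weight_insert_before i n j p x y : (i + n <= j)%N ->
  weight i n (insert j p x y) = weight i n x.
Proof.
move=> h; apply/funext => w; apply: eq_big_nat => t /andP[_ lt].
by rewrite /insert (leq_trans lt).
Qed.

Lemma weight_insert_after i n j p x y : (j < i)%N ->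
  weight i n (insert j p x y) = weight (i + p).-1 n x.
Proof.
move=> h; apply/funext => w; rewrite /weight.
have -> : ((i + p).-1 + n = (i + n + p).-1)%N by lia.
rewrite -(big_nat_shift_pred _ _ (fun t => (x t).2 w)); last by lia.
apply: eq_big_nat => t /andP[lt _]; have lt_jt := leq_trans h lt.
by rewrite /insert ltnNge ltnW //= gtn_eqF.
Qed.

Lemma insert_seq i n j p x y z : (j < n)%N ->
  insert i n (insert (i + j) p x y) z = insert i (n + p).-1 x z.
Proof.
move=> h; apply/funext => t; rewrite {1 3}/insert.
case: ltnP => [lt|le]; first by rewrite /insert ifT //; lia.
case: eqVneq => [_|ne]; first by rewrite weight_insert_in //; lia.
by rewrite /insert ifF ?ifF; [congr x| |]; lia.
Qed.

Lemma insert_par i n j p x y z : (i < j)%N ->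
  insert i n (insert (j + n).-1 p x y) z = insert j p (insert i n x z) y.
Proof.
move=> h; apply/funext => t; rewrite {1 3}/insert.
case: ltnP => [lt|le]; first by rewrite /insert !ifT //; lia.
case: (eqVneq t i) => [->|ne].
  by rewrite h /insert ltnn eqxx weight_insert_before //; lia.
case: (ltnP t j) => [lt|le'].
  by rewrite /insert ifT; [rewrite ifF ?(negbTE ne) //; lia | lia].
case: (eqVneq t j) => [->|ne'].
  rewrite /insert ifF ?ifT; [|lia..].
  by rewrite -/(insert _ _ _ _) weight_insert_after.
rewrite /insert ifF; last by lia.
rewrite ifF; last by lia.
rewrite ifF; last by lia.
rewrite ifF; last by lia.
by congr x; lia.
Qed.

Lemma shift_insert_par i n j x z : (i < j)%N ->
  shift j (insert i n x z) = shift (j + n).-1 x.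
Proof.
move=> h; apply/funext => t; rewrite /shift /insert ifF; last by lia.
by rewrite ifF; [congr x|]; lia.
Qed.

(** Sequential axiom: [h] lands inside the block of [g], and merging the inputs of [h] first and
    those of [g] next amounts to merging all of them at once. *)
Lemma comp_at_seq n p i j f g h : (j < n)%N ->
  comp_at p (i + j) (comp_at n i f g) h
  = comp_at (n + p).-1 i f (comp_at p j g h).
Proof.
move=> lt_jn; apply/funext => x; apply/funext => ev; rewrite /comp_at.
have -> : shift j (shift i x) = shift (i + j) x.
  by apply/funext => t; rewrite /shift addnA.
congr h; apply/funext => y; rewrite insert_shift.
by congr g; apply/funext => z; rewrite insert_seq.
Qed.

(** Parallel axiom: the two blocks are disjoint, so the insertions commute, and [g], being local,
    does not see one made after its block. It remains to exchange the evaluations of [h] and [g]. *)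
Lemma comp_at_par n p i j f g h x ev : (i < j)%N ->
  local n g -> exchanges h g -> linear_ops x -> commuting x ->
  comp_at p (j + n).-1 (comp_at n i f g) h x ev
  = comp_at n i (comp_at p j f h) g x ev.
Proof.
move=> lt_ij lg hg lx cx; rewrite /comp_at.
transitivity (h (shift (j + n).-1 x) (fun y => g (shift i x)
    (fun z => f (insert j p (insert i n x z) y) ev))).
  congr h; apply/funext => y.
  rewrite (lg _ (shift i x)); last first.
    by move=> t lt_tn; rewrite /shift /insert ifT //; lia.
  by congr g; apply/funext => z; rewrite insert_par.
rewrite hg; [|exact: linear_ops_shift..|by move=> a b w; exact: cx].
by congr g; apply/funext => z; rewrite shift_insert_par.
Qed.

(** * The graded right pre-Lie identity *)

Lemma sign_parity a b : odd a = odd b -> (-1) ^+ a = (-1) ^+ b :> C.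
Proof. by move=> h; rewrite -signr_odd h signr_odd. Qed.

(* The terms of the associator of f, g, h with h in a slot of f before that of g. *)
Definition comp_below (m n p : nat) (f g h : evalmap) : evalmap := fun x ev =>
  \sum_(i < m) \sum_(j < m | (j < i)%N)
    ((-1) ^+ (p.+1 * j) * (-1) ^+ (n.+1 * i)) *:
    comp_at p j (comp_at n i f g) h x ev.

(** With [g] in slot [i] of [f], the slot of [h] lies inside, before or after the block of [g].
    Inside, the sequential axiom gives the composite of [f] with that of [g] and [h]; before, the
    terms are those of [comp_below]; after, the parallel axiom turns them into those of [comp_below]
    with [g] and [h] interchanged. *)
Lemma ecomp_ecomp m n p f g h x ev : ev_linear h -> local n g ->
    exchanges h g -> linear_ops x -> commuting x ->
  ecomp (m + n).-1 p (ecomp m n f g) h x ev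
  = ecomp m (n + p).-1 f (ecomp n p g h) x ev + comp_below m n p f g h x ev
    + (-1) ^+ (n.+1 * p.+1) *: comp_below m p n f h g x ev.
Proof.
move=> eh lg xhg lx cx.
pose s i j : C := (-1) ^+ (p.+1 * j) * (-1) ^+ (n.+1 * i).
pose U i j := comp_at p j (comp_at n i f g) h x ev.
(* Linearity of [h] in its coefficient map extracts the sum over the slots [i] of [f] that receive
   [g]. *)
have -> : ecomp (m + n).-1 p (ecomp m n f g) h x ev
    = \sum_(i < m) \sum_(0 <= j < (m + n).-1) s i j *: U i j.
  rewrite exchange_big [RHS]big_mkord; apply: eq_bigr => j _.
  rewrite /comp_at eh; last exact: linear_ops_shift.
  by rewrite scaler_sumr; apply: eq_bigr => i _; rewrite scalerA.
under eq_bigr => i _.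
  rewrite (@big_nat_split _ i) /=; last by have := ltn_ord i; lia.
  rewrite [X in _ + X](@big_nat_split _ (i + n)) /=; last by have := ltn_ord i; lia.
  over.
rewrite !big_split /= addrCA -addrA; congr (_ + (_ + _)).
- apply: eq_bigr => i _; rewrite [in RHS]/comp_at [in RHS]/ecomp scaler_sumr.
  rewrite -{1}[i : nat]add0n big_addn addKn big_mkord; apply: eq_bigr => j _.
  rewrite /U addnC comp_at_seq // scalerA; congr (_ *: _).
  rewrite /s -!exprD; apply: sign_parity.
  (* For [n = 0] the inside range is empty, so [n] may be taken positive and [n + p - 1] is not
     truncated. *)
  case: {lg U s} n j => [[]//|n'] j; rewrite addSn /= !(oddD, oddM, oddS) /=.
  by case: (odd n'); case: (odd p); case: (odd i); case: (odd j).
- apply: eq_bigr => i _; rewrite big_mkord.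
  rewrite (big_ord_widen_cond m xpredT (fun j => s i j *: U i j)) //.
  exact: ltnW.
rewrite scaler_sumr.
(* Past the block of [g], slot [j + n - 1] of the composite is slot [j] of [f]. *)
transitivity (\sum_(i < m) \sum_(j < m | (i < j)%N)
    s i (j + n).-1 *: U i (j + n).-1).
  apply: eq_bigr => i _; rewrite -[(i + n)%N]/(i.+1 + n).-1.
  by rewrite -(big_nat_shift_pred _ _ (fun j => s i j *: U i j)) // big_geq_mkord.
rewrite (exchange_big_dep xpredT) //=; apply: eq_bigr => j _.
rewrite scaler_sumr; apply: eq_bigr => i lt_ij.
rewrite /U comp_at_par // scalerA; congr (_ *: _).
rewrite /s -!exprD; apply: sign_parity.
have [k ->] : exists k, nat_of_ord j = k.+1 by exists j.-1; lia.
rewrite addSn /= !(oddD, oddM, oddS) /=.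
by case: (odd n); case: (odd p); case: (odd i); case: (odd k).
Qed.

(** By [ecomp_ecomp] the associator is a sum of two [comp_below] terms, which are swapped, up to the
    sign, when [g] and [h] are. *)
Lemma ecomp_prelie m n p f g h x ev : ev_linear h -> ev_linear g ->
    local n g -> local p h -> exchanges h g -> exchanges g h ->
    linear_ops x -> commuting x ->
  ecomp (m + n).-1 p (ecomp m n f g) h x ev - ecomp m (n + p).-1 f (ecomp n p g h) x ev
  = (-1) ^+ (n.+1 * p.+1) *:
    (ecomp (m + p).-1 n (ecomp m p f h) g x ev
     - ecomp m (p + n).-1 f (ecomp p n h g) x ev).
Proof.
move=> eh eg lg lh xhg xgh lx cx; rewrite !ecomp_ecomp //.
have K (a b c : W) : a + b + c - a = b + c by rewrite -[a + b + c]addrA [a + _]addrC addrK.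
have K2 : (-1) ^+ (n.+1 * p.+1) * (-1) ^+ (p.+1 * n.+1) = 1 :> C.
  by rewrite [(p.+1 * _)%N]mulnC -exprD addnn -signr_odd odd_double.
by rewrite !K scalerDr scalerA K2 scale1r addrC.
Qed.

End Operad.

(** * Evaluation of cochains *)

Section CochainEvaluation.
Variables (C : fieldType) (A : assocConformalAlg C).
Local Notation der := (ca_der A).
Local Notation imd := (@im_der C A).
Implicit Type W : lmodType C.

Definition ceval W (n : nat) : precochain A n -> evalmap A W :=
  match n return precochain A n -> evalmap A W with
  | 0 => fun f _ ev => ev (repr f)
  | k.+1 => fun f x ev =>
      meval (fun j => (x j).2) ev (f (fun j : 'I_k.+1 => (x j).1))
  end.
Arguments ceval {W n} f x ev.

Definition balanced W (e : W -> W) (F : A -> W) :=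
  linear F /\ forall a, F (der a) = - e (F a).

(** For [n = 0] the weight is zero, so [ev] kills derivatives and the value of [ceval] is
    independent of the representative. *)
Definition admissible W (n : nat) (x : nat -> input A W) (ev : A -> W) :=
  [/\ linear_ops x, commuting x & balanced (weight 0 n x) ev].

Definition set_arg W (x : nat -> input A W) (t : nat) (a : A) : nat -> input A W :=
  fun j => if j == t then (a, (x j).2) else x j.

Lemma set_arg_op W (x : nat -> input A W) t a j : (set_arg x t a j).2 = (x j).2.
Proof. by rewrite /set_arg; case: ifP. Qed.

Lemma ceval_local W n (f : precochain A n) : local n (ceval f : evalmap A W).
Proof.
case: n f => //= k f x x' ev h.
have -> : (fun j : 'I_k.+1 => (x j).1) = fun j => (x' j).1.
  by apply/funext => j; rewrite h.
by apply: eq_meval => // j lt_jk; rewrite h // ltnW.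
Qed.

Lemma ceval_ev_linear W n (f : precochain A n) : ev_linear (ceval f : evalmap A W).
Proof.
case: n f => //= k f x l c ev hx; rewrite /meval.
under [RHS]eq_bigr => i _ do rewrite scaler_sumr.
rewrite exchange_big; apply: eq_bigr => m _ /=.
rewrite (linsum _ _ _ (lin_mact m hx)); apply: eq_bigr => i _.
by rewrite (linZ _ _ (lin_mact m hx)).
Qed.

Lemma ceval_exchanges W m n (f : precochain A m) (g : precochain A n) :
  exchanges (ceval f : evalmap A W) (ceval g).
Proof.
case: m f => //= k f; case: n g => //= l g x x' B lx lx' xx'.
exact: meval_exchange.
Qed.

(** On coefficients the derivation becomes minus the total operator, which moves outside the
    substitution because it commutes with every substituted operator. *)
Lemma meval_der W n k (x : nat -> input A W) ev (P : vpoly A k) :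
  admissible n x ev ->
  meval (fun j => (x j).2) ev (pder P) =
  - weight 0 n x (meval (fun j => (x j).2) ev P).
Proof.
case=> lx cx [lev dev]; rewrite /pder meval_map //; last first.
  by move=> c u v; rewrite linearP.
rewrite -scaleN1r -(linZ _ _ (weight_linear _ _ lx)).
have lT : linear (fun w => weight 0 n x (-1 *: w)).
  move=> c u v; rewrite scalerDr scalerA mulrC -scalerA.
  exact: weight_linear.
rewrite (meval_morph (T := fun w => weight 0 n x (-1 *: w)) (s' := fun j => (x j).2)) //.
  apply: eq_meval => // a /=.
  by rewrite dev (linZ _ _ (weight_linear _ _ lx)) scaleN1r.
move=> j u _ /=.
by rewrite commuting_weight // (linZ _ _ (lx j)).
Qed.

Lemma weight_recr W n (x : nat -> input A W) w :
  weight 0 n.+1 x w = weight 0 n x w + (x n).2 w.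
Proof. by rewrite /weight !add0n big_nat_recr. Qed.

Lemma weight0 W i (x : nat -> input A W) w : weight i 0 x w = 0.
Proof. by rewrite /weight addn0 big_geq. Qed.

(** In the last slot sesquilinearity yields [pder] plus all the variables. As [pder] evaluates to
    minus the sum of all operators, only minus the last operator survives. *)
Lemma ceval_balanced W n (f : precochain A n) (x : nat -> input A W) ev t :
    f \in cochain A n -> admissible n x ev -> (t < n)%N ->
  balanced (x t).2 (fun a => ceval f (set_arg x t a) ev).
Proof.
case: n f => //= k f /asboolP[f1 f2 f3] adm lt_tk.
have [lx cx [lev dev]] := adm.
pose i := Ordinal lt_tk; pose a0 := fun j : 'I_k.+1 => (x j).1.
have E a : meval (fun j => (set_arg x t a j).2) ev
    (f (fun j : 'I_k.+1 => (set_arg x t a j).1)) =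
    meval (fun j => (x j).2) ev (f (upd a0 i a)).
  rewrite (_ : (fun j : 'I_k.+1 => _) = upd a0 i a).
    by apply: eq_meval => // j _; rewrite set_arg_op.
  by apply/funext => j; rewrite /set_arg /upd -(inj_eq val_inj) /=; case: ifP.
have lm := lin_meval (k := k) lx lev.
split=> [c u v|a]; rewrite !E; first by rewrite f1 lm.
have -> : upd a0 i (der a) = upd (upd a0 i a) i (der (upd a0 i a i)).
  by apply/funext => j; rewrite /upd eqxx; case: ifP.
case: (ltnP t k) => [lt_tk'|le_kt].
  by rewrite f2 // linN // meval_lam.
have {}E : i = ord_max by apply: val_inj => /=; lia.
rewrite E f3 fctE (linD _ _ lm) (meval_der _ adm) fct_sumE (linsum _ _ _ lm).
set Q := f _; have -> : (x t).2 = (x k).2 by rewrite -[t]/(nat_of_ord i) E.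
rewrite weight_recr opprD -addrA addrCA /weight add0n big_mkord.
rewrite -[RHS]addr0; congr (_ + _); apply/eqP; rewrite addrC subr_eq0; apply/eqP.
by apply: eq_bigr => j _; rewrite meval_lam.
Qed.

(* The input at which f evaluates to itself; the last operator is forced by
   admissibility. *)
Definition generic_input k (a : nat -> A) : nat -> input A (vpoly A k) :=
  fun j => (a j, if (j < k)%N then lam j
                 else fun P => - (pder P + \sum_(t < k) lam t P)).

Lemma lin_generic k a : linear_ops (generic_input k a).
Proof.
move=> j /=; case: ifP => _; first exact: lin_lam.
move=> c P Q /=; rewrite lin_pder.
under eq_bigr => t _ do rewrite lin_lam.
by rewrite big_split /= -scaler_sumr addrACA -scalerDr opprD scalerN.
Qed.

Lemma pder_lam k j (P : vpoly A k) : pder (lam j P) = lam j (pder P).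
Proof. by apply: vpoly_map_lam => c x y; rewrite linearP. Qed.

Lemma commuting_generic k a : commuting (generic_input k a).
Proof.
have D j (P : vpoly A k) : - (pder (lam j P) + \sum_(t < k) lam t (lam j P))
    = lam j (- (pder P + \sum_(t < k) lam t P)).
  rewrite (linN _ (@lin_lam _ _ _ j)) (linD _ _ (@lin_lam _ _ _ j)).
  rewrite (linsum _ _ _ (@lin_lam _ _ _ j)) pder_lam; congr (- (_ + _)).
  by apply: eq_bigr => t _; rewrite lamC.
move=> i j P; rewrite /generic_input /=; case: ifP => _; case: ifP => _.
- exact: lamC.
- exact: esym (D i P).
- exact: D.
- reflexivity.
Qed.

Lemma admissible_generic k a : admissible k.+1 (generic_input k a) vconst.
Proof.
split; [exact: lin_generic | exact: commuting_generic | split].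
  exact: lin_vconst.
move=> v; rewrite weight_recr /= ltnn opprD opprK -pder_vconst addrCA.
rewrite /weight add0n big_mkord.
set S := \sum_(t < k) lam t _; set S' := \sum_(t < k) _.
have -> : S' = S by apply: eq_bigr => t _ /=; rewrite ltn_ord.
by rewrite addNr addr0.
Qed.

Lemma ceval_generic k (f : cmap A k) (a : nat -> A) :
  ceval (f : precochain A k.+1) (generic_input k a) vconst
  = f (fun j : 'I_k.+1 => a j).
Proof.
rewrite /= -[RHS]meval_vpoly; apply: eq_meval => // j lt_jk.
by rewrite lt_jk.
Qed.

Lemma ceval_lclass W x (ev : A -> W) v : admissible 0 x ev ->
  ceval (lclass imd v : precochain A 0) x ev = ev v.
Proof.
case=> _ _ [lev dev] /=; have /asboolP[y hy] := repr_lclass imd v.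
have -> : repr (lclass imd v) = v + der y by rewrite -hy addrC subrK.
by rewrite (linD _ _ lev) dev weight0 oppr0 addr0.
Qed.

(** In degree 0 the projection to the quotient is itself an admissible coefficient map; in positive
    degree the generic input returns the value of the cochain. *)
Lemma ceval_inj n (f g : precochain A n) :
  (forall W x (ev : A -> W), admissible n x ev -> ceval f x ev = ceval g x ev) ->
  f = g.
Proof.
case: n f g => [|k] f g h.
  have adm : admissible 0 (fun=> (0, id)) (lclass imd).
    split=> //; split; first exact: lin_lclass.
    move=> a; rewrite weight0 oppr0; apply/eqP.
    rewrite -(lin0 (@lin_lclass _ _ imd)) lclass_eq subr0.
    by apply/asboolP; exists a.
  by have := h _ _ _ adm; rewrite /= -!lclassP.
apply/funext => a; have := h _ _ _ (admissible_generic k (fun j => a (inord j))).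
rewrite !ceval_generic; congr (f _ = g _);
  by apply/funext => j; rewrite inord_val.
Qed.

Lemma ceval_linear W n x (ev : A -> W) : admissible n x ev ->
  linear (fun f : precochain A n => ceval f x ev).
Proof.
case: n => [|k] adm; have [lx _ [lev dev]] := adm; last first.
  by move=> c f g; apply: (lin_meval (k := k) lx lev).
move=> c f g; rewrite {1}[f]lclassP {1}[g]lclassP.
by rewrite -[X in ceval X](@lin_lclass _ _ imd) ceval_lclass // lev.
Qed.

(** Converse of [ceval_balanced]. Generic inputs suffice: their first operators are the variables,
    and their last one gives the rule for the last argument. *)
Lemma cochain_balanced n (f : precochain A n) :
    (forall W x (ev : A -> W) t, admissible n x ev -> (t < n)%N ->
      balanced (x t).2 (fun a => ceval f (set_arg x t a) ev)) ->
  f \in cochain A n.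
Proof.
case: n f => [//|k] f h; apply/asboolP.
have {}h (a : 'I_k.+1 -> A) (i : 'I_k.+1) :
    balanced (generic_input k (fun=> 0) i).2 (fun v => f (upd a i v)).
  have [h1 h2] := h _ _ _ _
    (admissible_generic k (fun j => a (inord j))) (ltn_ord i).
  suff E v : ceval f (set_arg (generic_input k (fun j => a (inord j))) i v) vconst
      = f (upd a i v) by split=> [c u v|v]; rewrite -!E ?h1 ?h2.
  rewrite -[RHS]meval_vpoly /=.
  rewrite (_ : (fun j : 'I_k.+1 => _) = upd a i v).
    by apply: eq_meval => // j lt_jk; rewrite set_arg_op /= lt_jk.
  apply/funext => j; rewrite /set_arg /upd -(inj_eq val_inj) /=.
  by case: ifP => //= _; rewrite inord_val.
have U a i : upd a i (a i) = a by apply/funext => j; rewrite /upd; case: eqP => // ->.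
split=> [a i|a i lt_ik|a].
- by have [] := h a i.
- by have [_ ->] := h a i; rewrite U /= lt_ik.
- have [_ ->] := h a ord_max; rewrite U /= ltnn opprK !fctE.
  by rewrite fct_sumE.
Qed.
End CochainEvaluation.
Arguments ceval {C A W n} f x ev.

(** * Evaluation of compositions *)

Section BulletEvaluation.
Variables (C : fieldType) (A : assocConformalAlg C).
Local Notation der := (ca_der A).
Implicit Type W : lmodType C.

Lemma weight_shift W i n (x : nat -> input A W) : weight 0 n (shift i x) = weight i n x.
Proof.
apply/funext => w; rewrite /weight add0n.
have := big_addn 0 (i + n) i xpredT (fun t => (x t).2 w).
by rewrite add0n addKn => ->; apply: eq_bigr => t _; rewrite /shift addnC.
Qed.

Lemma admissible_insert W m n r i (x : nat -> input A W) ev y :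
  r = (m + n).-1 -> admissible r x ev -> (i < m)%N ->
  admissible m (insert i n x y) ev.
Proof.
move=> -> [lx cx bx] lt_im; split; first exact: linear_ops_insert.
  exact: commuting_insert.
by rewrite weight_insert_in.
Qed.

Lemma set_arg_insert W i n (x : nat -> input A W) y z :
  set_arg (insert i n x y) i z = insert i n x z.
Proof.
apply/funext => j; rewrite /set_arg /insert.
by case: eqVneq => [->|//]; rewrite ltnn.
Qed.

(** A derivation in slot [i] of [f] acts by minus the inserted operator, which is the total operator
    of the block handed to [g]. For [n = 0] this makes insertion well defined on classes. *)
Lemma admissible_shift W m n r i (f : precochain A m) (x : nat -> input A W) ev :
  f \in cochain A m -> r = (m + n).-1 -> admissible r x ev -> (i < m)%N ->
  admissible n (shift i x) (fun y => ceval f (insert i n x y) ev).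
Proof.
move=> hf er adm lt_im; have [lx cx _] := adm; split.
- exact: linear_ops_shift.
- exact: commuting_shift.
have := ceval_balanced hf (admissible_insert 0 er adm lt_im) lt_im.
rewrite weight_shift {1}/insert ltnn eqxx /=.
by under eq_fun => y do rewrite set_arg_insert.
Qed.

(** [meval_morph] carries the evaluation through both substitutions of [circ_at], variable by
    variable. Only [merge_vars] at indices below [k] is consulted, so the last slot [i = k] fits
    in. *)
Lemma ceval_circ_at W k l K i (f : cmap A k) (g : cmap A l) x (ev : A -> W) :
    K = (k + l)%N -> admissible K.+1 x ev -> (i < k.+1)%N ->
  ceval (circ_at K f g i : precochain A K.+1) x ev
  = comp_at l.+1 i (ceval (f : precochain A k.+1))
      (ceval (g : precochain A l.+1)) x ev.
Proof.
move=> eK [lx cx [lev dev]] lt_ik; have lm := lin_meval (k := K) lx lev.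
have lamE j (P : vpoly A K) : (j < K)%N -> meval (fun j => (x j).2) ev (lam j P)
    = (x j).2 (meval (fun j => (x j).2) ev P).
  by move=> lt_jK; rewrite meval_lam.
rewrite /comp_at /= /circ_at.
rewrite (meval_morph (s' := fun j => (shift i x j).2) _ _ lm); last first.
  by move=> j P lt_jl; apply: lamE; lia.
rewrite (_ : segment i _ = fun j : 'I_l.+1 => (shift i x j).1); last first.
  by apply/funext => j; rewrite /segment /shift inordK //; have := ltn_ord j; lia.
apply: eq_meval => // y /=.
rewrite (_ : splice i l.+1 y _ = fun j : 'I_k.+1 => (insert i l.+1 x y j).1); last first.
  apply/funext => j; have := ltn_ord j; rewrite /splice /insert => lt_jk.
  case: ifP => [lt|_]; first by rewrite inordK //; lia.
  by case: ifP => // _; rewrite inordK //; lia.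
rewrite /msubst (meval_morph (s' := fun j => (insert i l.+1 x y j).2) _ _ lm).
  by apply: eq_meval => // v /=; rewrite meval_vconst.
move=> j P lt_jk; rewrite /merge_vars /insert.
case: ifP => [lt|_]; first by apply: lamE; lia.
case: ifP => [/eqP ji|_]; last by apply: lamE; lia.
rewrite fct_sumE (linsum _ _ _ lm) -weight_shift /weight /= add0n big_mkord.
by apply: eq_bigr => t _; rewrite lamE //; have := ltn_ord t; lia.
Qed.

Lemma ceval_sum W n I (r : seq I) (P : pred I) (F : I -> precochain A n) x (ev : A -> W) :
  admissible n x ev ->
  ceval (\sum_(i <- r | P i) F i) x ev = \sum_(i <- r | P i) ceval (F i) x ev.
Proof. by move=> adm; exact: (linsum _ _ _ (ceval_linear adm)). Qed.

Lemma ceval_circ W k l K (f : cmap A k) (g : cmap A l) x (ev : A -> W) :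
    K = (k + l)%N -> admissible K.+1 x ev ->
  ceval (circ K f g : precochain A K.+1) x ev
  = ecomp k.+1 l.+1 (ceval (f : precochain A k.+1))
      (ceval (g : precochain A l.+1)) x ev.
Proof.
move=> eK adm; rewrite /circ (@ceval_sum W K.+1) //; apply: eq_bigr => i _.
rewrite (linZ _ _ (ceval_linear adm)) (ceval_circ_at _ _ eK adm) //.
(* The exponents compared are [l * i] and [l.+2 * i]. *)
by congr (_ *: _); apply: sign_parity; rewrite !oddM /= negbK.
Qed.

Lemma ceval_circ_elt W k (f : cmap A k.+1) (g : precochain A 0) x (ev : A -> W) :
    admissible k.+1 x ev ->
  ceval (circ_elt k f (repr g) : precochain A k.+1) x ev
  = ecomp k.+2 0 (ceval (f : precochain A k.+2)) (ceval g) x ev.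
Proof.
move=> adm; have [lx cx [lev dev]] := adm; have lm := lin_meval (k := k) lx lev.
have lamE j (P : vpoly A k) : (j < k)%N -> meval (fun j => (x j).2) ev (lam j P)
    = (x j).2 (meval (fun j => (x j).2) ev P).
  by move=> lt_jK; rewrite meval_lam.
rewrite /ecomp big_ord_recr /= /circ_elt fctE (linD _ _ lm) (linsum _ _ _ lm).
have substE i s (b : A) : (i < k.+2)%N -> (forall j (P : vpoly A k), (j < k.+1)%N ->
      meval (fun j => (x j).2) ev (s j P)
      = (insert i 0 x b j).2 (meval (fun j => (x j).2) ev P)) ->
    meval (fun j => (x j).2) ev
      (msubst s (f (splice i 0 b (fun j : 'I_k.+1 => (x j).1))))
    = ceval (f : precochain A k.+2) (insert i 0 x b) ev.
  move=> lt_ik h; rewrite /=.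
  rewrite (_ : splice i 0 b _ = fun j : 'I_k.+2 => (insert i 0 x b j).1); last first.
    apply/funext => j; have := ltn_ord j; rewrite /splice /insert => lt_jk.
    case: ifP => [lt|?]; first by rewrite inordK //; lia.
    case: ifP => // ?; rewrite inordK //; lia.
  rewrite /msubst (meval_morph (s' := fun j => (insert i 0 x b j).2) _ _ lm) //.
    by apply: eq_meval => // v /=; rewrite meval_vconst.
congr (_ + _).
  apply: eq_bigr => i _; rewrite (linZ _ _ lm) mul1n; congr (_ *: _).
  apply: substE => [|j P lt_jk]; first exact: leqW (ltn_ord i).
  have lt_ik := ltn_ord i; rewrite /merge_vars /insert.
  case: ifP => [lt|?]; first by apply: lamE; lia.
  case: ifP => [?|?]; last by apply: lamE; lia.
  (* The variable set to zero matches the empty sum of operators attached to an inserted element. *)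
  by rewrite big_ord0 /= weight0 (lin0 lm).
rewrite (linZ _ _ lm) mul1n; congr (_ *: _).
apply: substE => // j P lt_jk; rewrite /insert lt_jk.
case: ifP => [|le_kj]; first exact: lamE.
have {lt_jk le_kj} -> : j = k by lia.
(* Variable [k] became minus [pder] minus the first [k] variables. Since [pder] evaluates to minus
   the sum of all [k + 1] operators, what is left is the operator of [x k]. *)
rewrite !fctE (linD _ _ lm) !(linN _ lm) (meval_der _ adm) fct_sumE (linsum _ _ _ lm).
rewrite opprK weight_recr addrAC /weight add0n big_mkord.
rewrite -[RHS]add0r; congr (_ + _); apply/eqP; rewrite subr_eq0; apply/eqP.
by apply: eq_bigr => t _; rewrite lamE.
Qed.

Lemma meval0 W s (F : A -> W) (P : vpoly A 0) :
  (forall j, linear (s j)) -> linear F -> meval s F P = F P@_mone.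
Proof.
move=> hs hF; rewrite (meval_wide (D := [fset mone]%fset)) ?(lin0 hF) //.
  by rewrite big_seq_fset1 mact_mone.
apply/fsubsetP => m _; have -> : m = mone by apply/eqP/cmP; case.
exact: fset11.
Qed.

Lemma ceval_bullet W m n r (f : precochain A m) (g : precochain A n) x (ev : A -> W) :
    f \in cochain A m -> r = (m + n).-1 -> admissible r x ev ->
  ceval (bullet r f g) x ev = ecomp m n (ceval f) (ceval g) x ev.
Proof.
case: m f => [|k] f hf er adm.
  have -> : bullet r f g = 0 by case: n g er => [|l] g er; case: r adm er.
  by rewrite (lin0 (ceval_linear adm)) /ecomp big_ord0.
case: n g er => [|l] g er; last first.
  case: r er adm => [|K] er adm; first by rewrite /= addnS in er.
  have -> : bullet K.+1 f g = circ K f g by case: (k) f {hf er}.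
  by apply: ceval_circ => //; move: er; rewrite /= addnS => -[].
case: k f hf er => [|k] f hf er; last first.
  rewrite addn0 /= in er; move: adm; rewrite er => adm.
  exact: ceval_circ_elt.
move: adm; rewrite er /= => adm; have [lx _ bx] := adm.
have := ceval_lclass (f (fun=> repr g))@_mone adm => /= ->; rewrite /ecomp big_ord1 muln0 expr0 scale1r.
rewrite /comp_at /= meval0; [|exact: linear_ops_insert|by case: bx].
by congr (ev (f _)@_ _); apply/funext => j; rewrite (ord1 j).
Qed.

(** * Compositions of cochains are cochains *)

Lemma weight_set_arg W i n (x : nat -> input A W) t a :
  weight i n (set_arg x t a) = weight i n x.
Proof. by apply/funext => w; apply: eq_bigr => j _; rewrite set_arg_op. Qed.

Lemma admissible_set_arg W n (x : nat -> input A W) ev t a :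
  admissible n x ev -> admissible n (set_arg x t a) ev.
Proof.
case=> lx cx bx; split; last by rewrite weight_set_arg.
  by move=> j; rewrite set_arg_op.
by move=> i j w; rewrite !set_arg_op.
Qed.

(** Handles an argument outside the block of [g]: it enters through the coefficient map, and [e]
    passes through [g] because it commutes with the operators of [g]. *)
Lemma balanced_ceval W n (g : precochain A n) (x : nat -> input A W)
    (e : W -> W) (B : A -> A -> W) :
    linear_ops x -> linear e -> (forall j w, (x j).2 (e w) = e ((x j).2 w)) ->
    (forall y, balanced e (B^~ y)) ->
  balanced e (fun a => ceval g x (B a)).
Proof.
move=> lx le ex hB; case: n g => [|l] g; first exact: hB.
split=> /= [|a].
  by apply: (meval_linF (k := l)) => // v; case: (hB v).
have le' : linear (fun w => - e w) by move=> c u v; rewrite le opprD scalerN.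
rewrite (meval_morph (T := fun w => - e w) (s' := fun j => (x j).2)) //.
  by apply: eq_meval => // y /=; case: (hB y) => _ ->.
by move=> j w _; rewrite (linN _ (lx j)) ex.
Qed.

Lemma balanced_sum W (e : W -> W) k (c : 'I_k -> C) (B : 'I_k -> A -> W) :
  linear e -> (forall i, balanced e (B i)) ->
  balanced e (fun a => \sum_i c i *: B i a).
Proof.
move=> le hB; split=> [d u v|a].
  rewrite scaler_sumr -big_split; apply: eq_bigr => i _ /=.
  by case: (hB i) => -> _; rewrite scalerDr !scalerA mulrC.
rewrite (linsum _ _ _ le) -sumrN; apply: eq_bigr => i _.
by case: (hB i) => _ ->; rewrite (linZ _ _ le) scalerN.
Qed.

Lemma bullet_cochain m n r (f : precochain A m) (g : precochain A n) :
    f \in cochain A m -> g \in cochain A n -> r = (m + n).-1 ->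
  bullet r f g \in cochain A r.
Proof.
move=> hf hg er; apply: cochain_balanced => W x ev t adm lt_tr.
have [lx cx _] := adm.
under eq_fun => a do rewrite (ceval_bullet g hf er (admissible_set_arg t a adm)).
apply: balanced_sum => // i; have lt_im := ltn_ord i; rewrite /comp_at.
(* Slot [t] lies before, inside or after the block of [g]; inside, the rule comes from slot [t - i]
   of [g], otherwise from [f]. *)
case: (ltnP t i) => [lt_ti|le_it].
  under eq_fun => a.
    have -> : shift i (set_arg x t a) = shift i x.
      by apply/funext => j; rewrite /shift /set_arg ifF //; lia.
    over.
  apply: balanced_ceval => //; [exact: linear_ops_shift|by move=> j w; exact: cx|].
  move=> y; have := ceval_balanced (t := t) hf (admissible_insert y er adm lt_im).
  rewrite {1}/insert lt_ti; under eq_fun => a.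
    have -> : set_arg (insert i n x y) t a = insert i n (set_arg x t a) y.
      apply/funext => j; rewrite /set_arg /insert -/(set_arg x t a) weight_set_arg.
      case: eqVneq => [->|ne]; first by rewrite lt_ti.
      by case: ifP => // ?; case: ifP => // ?; rewrite ifF //; lia.
    over.
  by apply; lia.
case: (ltnP t (i + n)) => [lt_tn|le_nt].
  have := ceval_balanced (t := t - i) hg (admissible_shift hf er adm lt_im).
  rewrite {1}/shift subnKC // => /(_ _)/wrap[|]; first by lia.
  congr balanced; apply/funext => a.
  have -> : set_arg (shift i x) (t - i) a = shift i (set_arg x t a).
    apply/funext => j; rewrite /set_arg /shift.
    by rewrite (_ : (j == t - i)%N = (i + j == t)%N) //; lia.
  congr ceval; apply/funext => y; congr ceval; apply/funext => j.
  rewrite /insert weight_set_arg /set_arg.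
  by case: ifP => [?|?]; [|case: ifP => // ?]; rewrite ifF //; lia.
under eq_fun => a.
  rewrite (ceval_local g (x' := shift i x)); last first.
    by move=> j lt_jn; rewrite /shift /set_arg ifF //; lia.
  over.
apply: balanced_ceval => //; [exact: linear_ops_shift|by move=> j w; exact: cx|].
(* Past the block, slot [t] of the composite is slot [t - n + 1] of [f]. *)
move=> y; have := ceval_balanced (t := (t - n).+1) hf (admissible_insert y er adm lt_im).
have -> : (insert i n x y (t - n).+1).2 = (x t).2.
  rewrite /insert ifF; last by lia.
  by rewrite ifF; [congr (x _).2|]; lia.
under eq_fun => a.
  have -> : set_arg (insert i n x y) (t - n).+1 a = insert i n (set_arg x t a) y.
    apply/funext => j; rewrite /set_arg /insert -/(set_arg x t a) weight_set_arg.
    case: (ltnP j i) => [?|?]; first by rewrite !ifF //; lia.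
    case: (eqVneq j i) => [->|?]; first by rewrite ifF //; lia.
    by rewrite (_ : ((j + n).-1 == t)%N = (j == (t - n).+1)%N) //; lia.
  over.
by apply; lia.
Qed.
End BulletEvaluation.

(** * The Jacobi identity for cochains *)

(** [f_gh] stands for [f] composed with the composite of [g] and [h], [fg_h] for the other
    bracketing; [u], [v], [w] are the signs of the pairs [f, g], then [f, h], then [g, h]. The three
    pre-Lie relations eliminate [fg_h], [gf_h] and [hf_g]. *)
Lemma prelie_jacobi (C : fieldType) (W : lmodType C) (u v w : C)
    (f_gh f_hg g_fh g_hf h_fg h_gf fg_h fh_g gf_h gh_f hf_g hg_f : W) :
    u * u = 1 -> v * v = 1 -> w * w = 1 ->
    fg_h - f_gh = w *: (fh_g - f_hg) ->
    gf_h - g_fh = v *: (gh_f - g_hf) ->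
    hf_g - h_fg = u *: (hg_f - h_gf) ->
  f_gh - w *: f_hg - (u * v) *: (gh_f - w *: hg_f)
  = (fg_h - u *: gf_h - (v * w) *: (h_fg - u *: h_gf))
    + u *: (g_fh - v *: g_hf - (u * w) *: (fh_g - v *: hf_g)).
Proof.
move=> u2 v2 w2 /eqP; rewrite subr_eq => /eqP -> /eqP; rewrite subr_eq => /eqP ->.
move=> /eqP; rewrite subr_eq => /eqP ->.
(* The nine remaining vectors are treated as formal basis vectors, so that the identity reduces to
   scalar ones modulo the squares of the signs. *)
pose x := [:: f_gh; f_hg; g_fh; g_hf; h_fg; h_gf; fh_g; gh_f; hg_f].
pose L (c : nat -> C) := \sum_(i < 9) c i *: x`_i.
have LD c d : L c + L d = L (fun i => c i + d i).
  by rewrite -big_split; apply: eq_bigr => i _; rewrite scalerDl.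
have LN c : - L c = L (fun i => - c i).
  by rewrite -sumrN; apply: eq_bigr => i _; rewrite scaleNr.
have LZ a c : a *: L c = L (fun i => a * c i).
  by rewrite scaler_sumr; apply: eq_bigr => i _; rewrite scalerA.
have xE k : (k < 9)%N -> x`_k = L (fun i => (i == k)%:R).
  move=> lt_k; rewrite /L (bigD1 (Ordinal lt_k)) //= eqxx scale1r big1 ?addr0 //.
  by move=> i; rewrite -(inj_eq val_inj) /= => /negbTE ->; rewrite scale0r.
rewrite -[f_gh]/(x`_0) -[f_hg]/(x`_1) -[g_fh]/(x`_2) -[g_hf]/(x`_3) -[h_fg]/(x`_4).
rewrite -[h_gf]/(x`_5) -[fh_g]/(x`_6) -[gh_f]/(x`_7) -[hg_f]/(x`_8) !xE //.
rewrite !(LD, LN, LZ); apply: eq_bigr => i _; congr (_ *: _).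
by ring: u2 v2 w2.
Qed.

Lemma scaler_swap (C : fieldType) (W : lmodType C) (a b : C) (w : W) :
  a *: (b *: w) = b *: (a *: w).
Proof. by rewrite !scalerA mulrC. Qed.

Section Jacobi.
Variables (C : fieldType) (A : assocConformalAlg C).
Implicit Type W : lmodType C.

Lemma bsignC m n : bsign C m n = bsign C n m.
Proof. by rewrite /bsign mulnC. Qed.

Lemma bsign_sqr m n : bsign C m n * bsign C m n = 1.
Proof. by rewrite /bsign -exprD addnn -signr_odd odd_double. Qed.

(** The shifted degree is additive under the bracket; [0 < n + p] excludes the truncated case. *)
Lemma bsign_pred m n p : (0 < n + p)%N ->
  bsign C m (n + p).-1 = bsign C m n * bsign C m p.
Proof.
move=> h; rewrite /bsign prednK // -exprD; apply: sign_parity.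
by rewrite !(oddM, oddD, oddS); case: (odd m); case: (odd n); case: (odd p).
Qed.

Lemma bracket_cochain m n (f : precochain A m) (g : precochain A n) :
  f \in cochain A m -> g \in cochain A n -> bracket f g \in cochain A (m + n).-1.
Proof.
move=> hf hg; rewrite /bracket -scaleNr addrC.
by apply: rpredD; [apply: rpredZ|]; apply: bullet_cochain; rewrite // addnC.
Qed.

Lemma ceval_bracket W m n r (f : precochain A m) (g : precochain A n) x (ev : A -> W) :
    f \in cochain A m -> g \in cochain A n -> r = (m + n).-1 ->
    admissible r x ev ->
  ceval (bracket f g) x ev = ecomp m n (ceval f) (ceval g) x ev
    - bsign C m n *: ecomp n m (ceval g) (ceval f) x ev.
Proof.
move=> hf hg -> adm; rewrite /bracket (linD _ _ (ceval_linear adm)) -scaleNr.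
rewrite (linZ _ _ (ceval_linear adm)) scaleNr.
by rewrite !ceval_bullet // addnC.
Qed.

Lemma ecomp_bracketr W m n p (f : precochain A m) (g : precochain A n)
    (h : precochain A p) x (ev : A -> W) :
    f \in cochain A m -> g \in cochain A n -> h \in cochain A p ->
    admissible (m + (n + p).-1).-1 x ev ->
  ecomp m (n + p).-1 (ceval f) (ceval (bracket g h)) x ev
  = ecomp m (n + p).-1 (ceval f) (ecomp n p (ceval g) (ceval h)) x ev
    - bsign C n p *:
      ecomp m (n + p).-1 (ceval f) (ecomp p n (ceval h) (ceval g)) x ev.
Proof.
move=> hf hg hh adm; rewrite /ecomp scaler_sumr -sumrB.
apply: eq_bigr => i _; rewrite (scaler_swap (bsign C n p)) -scalerBr; congr (_ *: _).
by apply: ceval_bracket => //; apply: (admissible_shift hf _ adm).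
Qed.

(** The bracket sits in the coefficient map of [f]; once it is expanded there, linearity in that map
    pulls its two terms out. *)
Lemma ecomp_bracketl W m n p (f : precochain A m) (g : precochain A n)
    (h : precochain A p) x (ev : A -> W) :
    g \in cochain A n -> h \in cochain A p ->
    admissible (m + (n + p).-1).-1 x ev ->
  ecomp (n + p).-1 m (ceval (bracket g h)) (ceval f) x ev
  = ecomp (n + p).-1 m (ecomp n p (ceval g) (ceval h)) (ceval f) x ev
    - bsign C n p *:
      ecomp (n + p).-1 m (ecomp p n (ceval h) (ceval g)) (ceval f) x ev.
Proof.
move=> hg hh adm; rewrite /ecomp scaler_sumr -sumrB.
apply: eq_bigr => i _; rewrite (scaler_swap (bsign C n p)) -scalerBr; congr (_ *: _).
have [lx _ _] := adm.
pose B y (j : 'I_2) := if j == ord0 then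
  ecomp n p (ceval g) (ceval h) (insert i m x y) ev else
  ecomp p n (ceval h) (ceval g) (insert i m x y) ev.
pose c (j : 'I_2) := if j == ord0 then 1 else - bsign C n p.
transitivity (ceval f (shift i x) (fun y => \sum_j c j *: B y j)).
  congr ceval; apply/funext => y; rewrite !big_ord_recl big_ord0 addr0 /c /B /=.
  rewrite scale1r scaleNr; apply: ceval_bracket => //.
  by apply: (admissible_insert _ _ adm); rewrite // addnC.
rewrite (ceval_ev_linear (n := m)); last exact: linear_ops_shift.
by rewrite !big_ord_recl big_ord0 addr0 /c /B /= scale1r scaleNr.
Qed.

Lemma ceval_prelie W m n p (f : precochain A m) (g : precochain A n)
    (h : precochain A p) x (ev : A -> W) : linear_ops x -> commuting x ->
  ecomp (m + n).-1 p (ecomp m n (ceval f) (ceval g)) (ceval h) x ev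
    - ecomp m (n + p).-1 (ceval f) (ecomp n p (ceval g) (ceval h)) x ev
  = bsign C n p *:
    (ecomp (m + p).-1 n (ecomp m p (ceval f) (ceval h)) (ceval g) x ev
     - ecomp m (p + n).-1 (ceval f) (ecomp p n (ceval h) (ceval g)) x ev).
Proof.
move=> lx cx; apply: ecomp_prelie => //; try exact: ceval_ev_linear;
  by [exact: ceval_local | exact: ceval_exchanges].
Qed.

Lemma ecomp0l W n (f g : evalmap A W) x ev : ecomp 0 n f g x ev = 0.
Proof. by rewrite /ecomp big_ord0. Qed.

Lemma ecomp_ecomp0l W m k n (f g h : evalmap A W) x ev :
  ecomp m k f (ecomp 0 n g h) x ev = 0.
Proof. by apply: big1 => i _; rewrite /comp_at ecomp0l scaler0. Qed.

Lemma ceval0 W n x (ev : A -> W) : admissible n x ev ->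
  ceval (0 : precochain A n) x ev = 0.
Proof. by move=> adm; exact: (lin0 (ceval_linear adm)). Qed.

(** Serves for a zero whose degree differs from the one for which [x] is admissible. *)
Lemma ceval0S W n x (ev : A -> W) : linear_ops x -> linear ev ->
  ceval (0 : precochain A n.+1) x ev = 0.
Proof. by move=> lx lev; exact: (lin0 (lin_meval (k := n) lx lev)). Qed.

(** * Bilinearity and antisymmetry of the bracket of cochains *)

Lemma bracket00 (f g : precochain A 0) : bracket f g = 0.
Proof. by rewrite /bracket /= scaler0 subr0. Qed.

Lemma bracketPr m n (f : precochain A m) (g h : precochain A n) c :
    f \in cochain A m -> g \in cochain A n -> h \in cochain A n ->
  bracket f (c *: g + h) = c *: bracket f g + bracket f h.
Proof.
move=> hf hg hh; apply: ceval_inj => W x ev adm; have [lx _ [lev _]] := adm.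
have hgh : c *: g + h \in cochain A n by apply: rpredD => //; apply: rpredZ.
rewrite (ceval_linear adm) !(ceval_bracket _ _ _ adm) //.
suff [-> ->] : ecomp m n (ceval f) (ceval (c *: g + h)) x ev
      = c *: ecomp m n (ceval f) (ceval g) x ev + ecomp m n (ceval f) (ceval h) x ev
    /\ ecomp n m (ceval (c *: g + h)) (ceval f) x ev
      = c *: ecomp n m (ceval g) (ceval f) x ev + ecomp n m (ceval h) (ceval f) x ev.
  by rewrite !scalerDr opprD addrACA scaler_swap scalerN.
split; rewrite /ecomp scaler_sumr -big_split; apply: eq_bigr => i _ /=.
  rewrite scaler_swap -scalerDr; congr (_ *: _).
  exact: (ceval_linear (admissible_shift hf erefl adm (ltn_ord i))).
rewrite scaler_swap -scalerDr; congr (_ *: _); rewrite /comp_at.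
pose B y (j : 'I_2) := ceval (if j == ord0 then g else h) (insert i m x y) ev.
pose d (j : 'I_2) := if j == ord0 then c else 1.
transitivity (ceval f (shift i x) (fun y => \sum_j d j *: B y j)).
  congr ceval; apply/funext => y; rewrite !big_ord_recl big_ord0 addr0 /d /B /=.
  rewrite scale1r.
  by apply: (ceval_linear (admissible_insert y _ adm _)); rewrite // addnC.
rewrite (ceval_ev_linear (n := m)); last exact: linear_ops_shift.
by rewrite !big_ord_recl big_ord0 addr0 /d /B /= scale1r.
Qed.

Lemma bracket0r m n (f : precochain A m) : f \in cochain A m ->
  bracket f (0 : precochain A n) = 0.
Proof.
move=> hf; have := bracketPr (g := 0 : precochain A n) (h := 0) 1 hf (rpred0 _) (rpred0 _).
by rewrite !scale1r addr0 => /eqP; rewrite addrC -subr_eq subrr eq_sym => /eqP.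
Qed.

Lemma ceval_bracketC W m n r (f : precochain A m) (g : precochain A n) x (ev : A -> W) :
    f \in cochain A m -> g \in cochain A n -> r = (m + n).-1 ->
    admissible r x ev ->
  ceval (bracket f g) x ev = - (bsign C m n *: ceval (bracket g f) x ev).
Proof.
move=> hf hg er adm; rewrite !(@ceval_bracket _ _ _ r) //; last by rewrite addnC.
by rewrite scalerBr scalerA [bsign C n m]bsignC bsign_sqr scale1r opprB.
Qed.

Lemma bracket0l m n (g : precochain A n) : g \in cochain A n ->
  bracket (0 : precochain A m) g = 0.
Proof.
move=> hg; apply: ceval_inj => W x ev adm.
rewrite (ceval_bracketC _ hg _ adm) ?rpred0 // bracket0r //.
by rewrite !ceval0 ?scaler0 ?oppr0 // addnC.
Qed.

Lemma ceval_bracket_bracketr W m n p N (f : precochain A m) (g : precochain A n)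
    (h : precochain A p) x (ev : A -> W) :
    f \in cochain A m -> g \in cochain A n -> h \in cochain A p ->
    N.+2 = (m + n + p)%N -> admissible N x ev ->
  ceval (bracket f (bracket g h)) x ev
  = ecomp m (n + p).-1 (ceval f) (ecomp n p (ceval g) (ceval h)) x ev
    - bsign C n p *:
      ecomp m (n + p).-1 (ceval f) (ecomp p n (ceval h) (ceval g)) x ev
    - (bsign C m n * bsign C m p) *:
      (ecomp (n + p).-1 m (ecomp n p (ceval g) (ceval h)) (ceval f) x ev
       - bsign C n p *:
         ecomp (n + p).-1 m (ecomp p n (ceval h) (ceval g)) (ceval f) x ev).
Proof.
move=> hf hg hh eN adm; have [np|np] := posnP (n + p).
  (* The inner bracket vanishes but is kept in degree 0, so the outer one has degree [N + 1] instead
     of [N]. *)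
  have [n0 p0] : n = 0 /\ p = 0 by lia.
  subst n p; rewrite bracket00 bracket0r // !ecomp_ecomp0l !ecomp0l.
  have [lx _ [lev _]] := adm.
  case: m f hf eN => [|[|m]] f hf eN; [lia..|].
  by rewrite (ceval0S _ lx lev) !(scaler0, subr0).
have eq : (m + (n + p).-1).-1 = N by lia.
rewrite (@ceval_bracket _ _ _ N) ?bracket_cochain //.
by rewrite ecomp_bracketr ?ecomp_bracketl ?eq // bsign_pred.
Qed.

Lemma ceval_bracket_bracketl W m n p N (f : precochain A m) (g : precochain A n)
    (h : precochain A p) x (ev : A -> W) :
    f \in cochain A m -> g \in cochain A n -> h \in cochain A p ->
    N.+2 = (m + n + p)%N -> admissible N x ev ->
  ceval (bracket (bracket f g) h) x ev
  = ecomp (m + n).-1 p (ecomp m n (ceval f) (ceval g)) (ceval h) x ev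
    - bsign C m n *:
      ecomp (m + n).-1 p (ecomp n m (ceval g) (ceval f)) (ceval h) x ev
    - (bsign C m p * bsign C n p) *:
      (ecomp p (m + n).-1 (ceval h) (ecomp m n (ceval f) (ceval g)) x ev
       - bsign C m n *:
         ecomp p (m + n).-1 (ceval h) (ecomp n m (ceval g) (ceval f)) x ev).
Proof.
move=> hf hg hh eN adm; have [mn|mn] := posnP (m + n).
  have [m0 n0] : m = 0 /\ n = 0 by lia.
  subst m n; rewrite bracket00 bracket0l // !ecomp_ecomp0l !ecomp0l.
  have [lx _ [lev _]] := adm.
  case: p h hh eN => [|[|p]] h hh eN; [lia..|].
  by rewrite (ceval0S _ lx lev) !(scaler0, subr0).
have eq : (p + (m + n).-1).-1 = N by lia.
rewrite (@ceval_bracket _ _ _ N) ?bracket_cochain //; last by lia.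
rewrite ecomp_bracketr ?ecomp_bracketl ?eq // [bsign C (m + n).-1 p]bsignC.
rewrite bsign_pred //.
by rewrite (bsignC p m) (bsignC p n).
Qed.

(** The pre-Lie identities with [f], [g] and [h] as outer map feed [prelie_jacobi]. The three terms
    have types with different indices; evaluating at the common degree [N] replaces casts. *)
Lemma ceval_jacobi W m n p N (f : precochain A m) (g : precochain A n)
    (h : precochain A p) x (ev : A -> W) :
    f \in cochain A m -> g \in cochain A n -> h \in cochain A p ->
    N.+2 = (m + n + p)%N -> admissible N x ev ->
  ceval (bracket f (bracket g h)) x ev
  = ceval (bracket (bracket f g) h) x ev
    + bsign C m n *: ceval (bracket g (bracket f h)) x ev.
Proof.
move=> hf hg hh eN adm; have [lx cx _] := adm.
rewrite (ceval_bracket_bracketl hf hg hh eN adm).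
rewrite (ceval_bracket_bracketr hf hg hh eN adm).
rewrite (@ceval_bracket_bracketr _ _ _ _ N g f h) // ?[(n + m)%N]addnC //.
rewrite (bsignC n m); apply: prelie_jacobi; rewrite ?bsign_sqr //.
- by have := ceval_prelie f g h ev lx cx; rewrite (addnC p n).
- by have := ceval_prelie g f h ev lx cx; rewrite (addnC p m) (addnC n m).
- have := ceval_prelie h f g ev lx cx.
  by rewrite (addnC p n) (addnC n m) (addnC p m).
Qed.

Lemma mulc_cochain : (@mulc C A : precochain A 2) \in cochain A 2.
Proof.
apply/asboolP; split=> [a i|a i lt_i|a].
- move=> c u v; rewrite /mulc /upd.
  case: (eqVneq i ord0) => [->|/negbTE ne0] /=; first exact: ca_mul_linearl.
  have -> : i = ord_max.
    by apply: val_inj; move: ne0; rewrite -(inj_eq val_inj); case: i => [[|[|]]].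
  exact: ca_mul_linearr.
- have -> : i = ord0 by apply: val_inj; case: i lt_i => [[|[|]]].
  by rewrite /mulc /upd /= ca_mul_derl.
- by rewrite /mulc /upd /= ca_mul_derr fctE fct_sumE big_ord1.
Qed.

(** The product with [f] in either slot gives the two outer terms of the differential, and [f]
    composed with the product gives the alternating sum; in degree 0 only the former occur. *)
Lemma diff_bracket n (f : precochain A n) :
  diff f = (-1) ^+ n.+1 *: bracket (@mulc C A : precochain A 2) f.
Proof.
case: n f => [|k] f; rewrite /bracket.
  rewrite /= scaler0 subr0 expr1 scaleN1r; apply/funext => a.
  rewrite /diff0 /circ_elt !fctE big_ord1 expr0 scale1r expr1 scaleN1r opprD opprK.
  have in0 : inord 0 = ord0 :> 'I_1 by apply: val_inj; rewrite /= inordK.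
  rewrite addrC; apply: (f_equal2 (fun u v => - u + v));
    rewrite /mul_at /mulc /splice /= in0.
    by apply: eq_meval => // j; rewrite ltnS leqn0 => /eqP ->; rewrite /merge_vars big_ord0.
  apply: eq_meval => // j _; apply/funext => P; rewrite big_ord0.
  exact: esym (subr0 _).
have -> : bullet (2 + k.+1).-1 (@mulc C A : precochain A 2) f
  = circ k.+1 (@mulc C A) f by [].
have -> : bullet (2 + k.+1).-1 f (@mulc C A : precochain A 2)
  = circ k.+1 f (@mulc C A) by case: (k) f.
rewrite [circ _ (@mulc C A) f]/circ !big_ord_recl big_ord0 addr0 /= /diffS.
rewrite -[bump 0 0]/1%N muln0 expr0 scale1r muln1.
set P0 := circ_at _ _ _ 0; set P1 := circ_at _ _ _ 1; set D := circ _ _ _.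
have -> : \sum_(i < k.+1) (-1) ^+ i.+1 *: circ_at k.+1 f (@mulc C A) i = - D.
  rewrite /D /circ -sumrN; apply: eq_bigr => i _.
  by rewrite mul1n exprS mulN1r scaleNr.
have e1 : (-1) ^+ k.+2 * (-1) ^+ k = 1 :> C.
  by rewrite -exprD -signr_odd oddD /= negbK addbb.
have e2 : (-1) ^+ k.+2 * bsign C 2 k.+1 = 1 :> C.
  rewrite /bsign -exprD -signr_odd oddD oddM /= !negbK.
  by case: (odd k).
by rewrite scalerBr scalerDr !scalerA e1 e2 !scale1r addrC addrA.
Qed.
End Jacobi.

(** * Cohomology *)

Section DirectSumInjection.
Variables (C : fieldType) (V : nat -> lmodType C).

Lemma dval_dinj n (v : V n) : dval (dinj n v) n = v.
Proof. exact: dfwith_in. Qed.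

Lemma dval_dinj_out n (v : V n) d : n != d -> dval (dinj n v) d = 0.
Proof. exact: dfwith_out. Qed.

Lemma dval_dinj_linear n d : linear (fun v : V n => dval (dinj n v) d).
Proof.
move=> c u v; have [<-|ne] := eqVneq n d; first by rewrite !dval_dinj.
by rewrite !dval_dinj_out // scaler0 addr0.
Qed.

Lemma dval_dinj0 n d : dval (dinj n (0 : V n)) d = 0.
Proof. by have := lin0 (@dval_dinj_linear n d). Qed.

Lemma dinj_linear n : linear (dinj n : V n -> dsum V).
Proof. by move=> c u v; apply: dsumP => d; rewrite dval_dinj_linear. Qed.

End DirectSumInjection.

Section Cohomology.
Variables (C : fieldType) (A : assocConformalAlg C).
Implicit Type W : lmodType C.
Local Notation mu := (@mulc C A : precochain A 2).

(** * Brackets of cocycles and coboundaries *)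

Lemma bracketPl m n (f g : precochain A m) (h : precochain A n) c :
    f \in cochain A m -> g \in cochain A m -> h \in cochain A n ->
  bracket (c *: f + g) h = c *: bracket f h + bracket g h.
Proof.
move=> hf hg hh; apply: ceval_inj => W x ev adm.
have hfg : c *: f + g \in cochain A m by apply: rpredD => //; apply: rpredZ.
have adm' : admissible (n + m).-1 x ev by rewrite addnC.
rewrite (ceval_linear adm) (ceval_bracketC hfg hh erefl adm).
rewrite (ceval_bracketC hf hh erefl adm) (ceval_bracketC hg hh erefl adm) bracketPr //.
by rewrite (ceval_linear adm') scalerDr opprD scaler_swap scalerN.
Qed.

Lemma zval_cochain m (f : Zcocycle A m) : zval f \in cochain A m.
Proof. by case: f => f /= P; case/andP: P. Qed.

Lemma diff_zval m (f : Zcocycle A m) : diff (zval f) = 0.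
Proof. by case: f => f /= P; case/andP: P => _ /eqP. Qed.

Lemma bracket_mulc_eq0 m (f : precochain A m) : diff f = 0 -> bracket mu f = 0.
Proof.
move=> df; have := diff_bracket f; rewrite df => /esym/eqP.
by rewrite scaler_eq0 signr_eq0 => /eqP.
Qed.

(** Both cocycles have zero bracket with [mu], hence so does their bracket, by Jacobi. *)
Lemma bracket_cocycle m n (f : Zcocycle A m) (g : Zcocycle A n) :
  bracket (zval f) (zval g) \in cocycle A (m + n).-1.
Proof.
have hf := zval_cochain f; have hg := zval_cochain g.
apply/andP; split; first exact: bracket_cochain.
apply/eqP; case: (posnP (m + n)) => [e|mn].
  have [m0 n0] : m = 0 /\ n = 0 by lia.
  subst m n; rewrite bracket00; exact: (lin0 (@diff_linear _ _ _)).
rewrite diff_bracket; suff -> : bracket mu (bracket (zval f) (zval g)) = 0.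
  exact: scaler0.
apply: (@ceval_inj _ _ (2 + (m + n).-1).-1) => W x ev adm.
rewrite (ceval_jacobi (mulc_cochain A) hf hg _ adm); last by lia.
rewrite !bracket_mulc_eq0 ?diff_zval // bracket0l // bracket0r //.
have e1 : ((2 + m).-1 + n).-1 = (2 + (m + n).-1).-1 by lia.
have e2 : (m + (2 + n).-1).-1 = (2 + (m + n).-1).-1 by lia.
by rewrite !ceval0 ?e1 ?e2 // scaler0 addr0.
Qed.

Definition Zbracket m n (f : Zcocycle A m) (g : Zcocycle A n) :
  Zcocycle A (m + n).-1 := ZCocycle (bracket_cocycle f g).

Lemma ZbracketPr m n (f : Zcocycle A m) : linear (@Zbracket m n f).
Proof. by move=> c g h; apply: val_inj; apply: bracketPr; exact: zval_cochain. Qed.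

Lemma ZbracketPl m n (g : Zcocycle A n) : linear ((@Zbracket m n)^~ g).
Proof. by move=> c f h; apply: val_inj; apply: bracketPl; exact: zval_cochain. Qed.

Lemma Zcocycle_inj n (y z : Zcocycle A n) :
  (forall W x (ev : A -> W), admissible n x ev ->
     ceval (zval y) x ev = ceval (zval z) x ev) -> y = z.
Proof. by move=> h; apply: val_inj; apply: ceval_inj. Qed.

Lemma coboundary_diff N q (z : Zcocycle A N) (g : precochain A q) :
    N = q.+1 -> g \in cochain A q ->
    (forall W x (ev : A -> W), admissible N x ev ->
       ceval (zval z) x ev = ceval (diff g) x ev) ->
  z \in coboundary A N.
Proof.
move=> eN; subst N => hg h; apply/asboolP; exists g => //.
exact: ceval_inj.
Qed.

(** If [g] is the differential of [g'], it is up to sign the bracket of [mu] and [g']. Jacobi and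
    the vanishing of the bracket of [mu] and [f] then exhibit a multiple of the bracket of [f] and
    [g'] as a primitive. *)
Lemma Zbracket_coboundaryr m n (f : Zcocycle A m) (g : Zcocycle A n) :
  g \in coboundary A n -> Zbracket f g \in coboundary A (m + n).-1.
Proof.
have hf := zval_cochain f.
case: n g => [|q] g; first by move/eqP => ->; rewrite (lin0 (ZbracketPr f)) rpred0.
case/asboolP=> g' hg' eg.
have jac W x (ev : A -> W) : admissible (m + q.+1).-1 x ev ->
    ceval (bracket (zval f) (zval g)) x ev
    = ((-1) ^+ q.+1 * bsign C 2 m) *: ceval (bracket mu (bracket (zval f) g')) x ev.
  move=> adm; have hmu := mulc_cochain A.
  have hb : bracket mu g' \in cochain A q.+1 by exact: bracket_cochain.
  rewrite (ceval_jacobi hmu hf hg' _ adm); last by lia.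
  rewrite (bracket_mulc_eq0 (diff_zval f)) bracket0l //.
  have e1 : ((2 + m).-1 + q).-1 = (m + q.+1).-1 by lia.
  rewrite ceval0 ?e1 // add0r scalerA -mulrA bsign_sqr mulr1 eg diff_bracket.
  have := bracketPr (n := q.+1) ((-1) ^+ q.+1) hf hb (rpred0 _).
  by rewrite addr0 bracket0r // addr0 => ->; rewrite (linZ _ _ (ceval_linear adm)).
case: (posnP (m + q)) => [e|mq].
  (* The result has degree 0, where zero is the only coboundary; it vanishes because the bracket of
     [f] and [g'] does. *)
  have [m0 q0] : m = 0 /\ q = 0 by lia.
  subst m q; rewrite (_ : Zbracket f g = 0) ?rpred0 //.
  apply: Zcocycle_inj => W x ev adm; apply: (etrans (jac _ _ _ adm)).
  rewrite bracket00 bracket0r ?mulc_cochain //.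
  have [lx _ [lev _]] := adm.
  by rewrite (ceval0S _ lx lev) scaler0 (ceval0 adm).
(* The last factor cancels the sign of [diff_bracket] in degree [(m + q).-1]. *)
pose c : C := (-1) ^+ q.+1 * bsign C 2 m * (-1) ^+ (m + q).-1.+1.
have hfg : bracket (zval f) g' \in cochain A (m + q).-1 by exact: bracket_cochain.
apply: (coboundary_diff (g := c *: bracket (zval f) g')); [lia|exact: rpredZ|].
move=> W x ev adm; apply: (etrans (jac _ _ _ adm)).
rewrite (linZ _ _ (@diff_linear _ _ _)) diff_bracket.
have e2 : (m + q.+1).-1 = (2 + (m + q).-1).-1 by lia.
have adm' : admissible (2 + (m + q).-1).-1 x ev by rewrite -e2.
rewrite !(linZ _ _ (ceval_linear adm')) scalerA; congr (_ *: _).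
by rewrite /c -[RHS]mulrA -expr2 sqrr_sign mulr1.
Qed.

Lemma coboundary_transport N N' (z : Zcocycle A N) (z' : Zcocycle A N') :
    N = N' -> (forall W x (ev : A -> W), admissible N x ev ->
      ceval (zval z) x ev = ceval (zval z') x ev) ->
  z' \in coboundary A N' -> z \in coboundary A N.
Proof. by move=> eN; subst N' => /Zcocycle_inj ->. Qed.

Lemma ceval_zvalZ W m (c : C) (z : Zcocycle A m) x (ev : A -> W) : admissible m x ev ->
  ceval (zval (c *: z)) x ev = c *: ceval (zval z) x ev.
Proof. by move=> adm; rewrite -(linZ _ _ (ceval_linear adm)). Qed.

Lemma Zbracket_coboundaryl m n (f : Zcocycle A m) (g : Zcocycle A n) :
  f \in coboundary A m -> Zbracket f g \in coboundary A (m + n).-1.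
Proof.
move=> hf; apply: (coboundary_transport (z' := (- bsign C m n) *: Zbracket g f)).
- by rewrite addnC.
- move=> W x ev adm; have adm' : admissible (n + m).-1 x ev by rewrite addnC.
  rewrite ceval_zvalZ // /= scaleNr.
  by apply: (ceval_bracketC _ _ _ adm); rewrite ?zval_cochain.
by apply: rpredZ; apply: Zbracket_coboundaryr.
Qed.

(** * The bracket on cohomology and on the direct sum *)

Definition Hbracket m n (f : HH A m) (g : HH A n) : HH A (m + n).-1 :=
  HHclass (Zbracket (repr f) (repr g)).

(** Changing one representative at a time alters the bracket by a bracket with a coboundary. *)
Lemma Hbracket_class m n (f : Zcocycle A m) (g : Zcocycle A n) :
  Hbracket (HHclass f) (HHclass g) = HHclass (Zbracket f g).
Proof.
apply/eqP; rewrite /Hbracket /HHclass lclass_eq.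
set f' := repr _; set g' := repr _.
have -> : Zbracket f' g' - Zbracket f g
    = Zbracket (f' - f) g' + Zbracket f (g' - g).
  rewrite (linD _ _ (ZbracketPl g')) (linN _ (ZbracketPl g')).
  by rewrite (linD _ _ (ZbracketPr f)) (linN _ (ZbracketPr f)) addrA subrK.
apply: rpredD; [apply: Zbracket_coboundaryl|apply: Zbracket_coboundaryr];
  exact: repr_lclass.
Qed.

Lemma HHclassP n (u : HH A n) : exists z, u = HHclass z.
Proof. by exists (repr u); exact: lclassP. Qed.

Lemma HHclass_linear n : linear (@HHclass C A n).
Proof. exact: lin_lclass. Qed.

Lemma HbracketPr m n (f : HH A m) : linear (@Hbracket m n f).
Proof.
have [f' ->] := HHclassP f; move=> c g h.
have [g' ->] := HHclassP g; have [h' ->] := HHclassP h.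
by rewrite -HHclass_linear !Hbracket_class ZbracketPr HHclass_linear.
Qed.

Lemma HbracketPl m n (g : HH A n) : linear ((@Hbracket m n)^~ g).
Proof.
have [g' ->] := HHclassP g; move=> c f h.
have [f' ->] := HHclassP f; have [h' ->] := HHclassP h.
by rewrite -HHclass_linear !Hbracket_class ZbracketPl HHclass_linear.
Qed.

(* dval (dinj i u) d is u, without a cast, if i = d, and 0 otherwise. *)
Definition HHbracket_val (x y : HHtot A) (d : nat) : HH A d :=
  \sum_(i < d.+2) \sum_(j < d.+2)
    dval (dinj (i + j).-1 (Hbracket (dval x i) (dval y j))) d.

Definition HHbracket (x y : HHtot A) : HHtot A.
Proof.
exists (HHbracket_val x y); apply/asboolP.
have [M hM] := dsum_bound x; have [N hN] := dsum_bound y.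
(* If [(i + j).-1] is at least [M + N], then [i] is at least [M] or [j] is at least [N]. *)
exists (M + N)%N => d le_d; apply: big1 => i _; apply: big1 => j _.
have [e|ne] := eqVneq (i + j).-1 d; last exact: dval_dinj_out.
case: (leqP M i) => [/hM ->|lt_i].
  rewrite (lin0 (HbracketPl (m := i) (dval y j))).
  exact: dval_dinj0.
rewrite hN; last by lia.
rewrite (lin0 (HbracketPr (n := j) (dval x i))).
exact: dval_dinj0.
Defined.

Lemma HHbracketPr x : linear (HHbracket x).
Proof.
move=> c y z; apply: dsumP => d /=.
rewrite /HHbracket_val scaler_sumr -big_split; apply: eq_bigr => i _ /=.
rewrite scaler_sumr -big_split; apply: eq_bigr => j _ /=.
by rewrite HbracketPr; exact: (@dval_dinj_linear C (@HH C A) (i + j).-1 d).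
Qed.

Lemma HHbracketPl y : linear (HHbracket^~ y).
Proof.
move=> c x z; apply: dsumP => d /=.
rewrite /HHbracket_val scaler_sumr -big_split; apply: eq_bigr => i _ /=.
rewrite scaler_sumr -big_split; apply: eq_bigr => j _ /=.
by rewrite HbracketPl; exact: (@dval_dinj_linear C (@HH C A) (i + j).-1 d).
Qed.

Lemma HHbracket_dinj m n (f : HH A m) (g : HH A n) :
  HHbracket (dinj m f) (dinj n g) = dinj (m + n).-1 (Hbracket f g).
Proof.
apply: dsumP => d; rewrite -[LHS]/(HHbracket_val _ _ _) /HHbracket_val.
pose T i j := dval (dinj (i + j).-1
  (Hbracket (dval (dinj m f) i) (dval (dinj n g) j))) d.
have Ti i j : m != i -> T i j = 0.
  move=> ne; rewrite /T [dval (dinj m f) i]dval_dinj_out // (lin0 (HbracketPl _)).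
  exact: dval_dinj0.
have Tj i j : n != j -> T i j = 0.
  move=> ne; rewrite /T [dval (dinj n g) j]dval_dinj_out // (lin0 (HbracketPr _)).
  exact: dval_dinj0.
have -> : dval (dinj (m + n).-1 (Hbracket f g)) d = T m n by rewrite /T !dval_dinj.
rewrite -/(T _ _).
(* A degree of [d + 2] or more makes the bracket land above [d], so bounding the sums by [d.+2]
   loses nothing. *)
have T0 : (d.+2 <= m)%N || (d.+2 <= n)%N -> T m n = 0.
  by move=> h; rewrite /T dval_dinj_out //; apply/eqP; lia.
case: (ltnP m d.+2) => [lt_m|le_m]; last first.
  rewrite T0 ?le_m // big1 // => i _; rewrite big1 // => j _; apply: Ti.
  by rewrite gtn_eqF // (leq_trans (ltn_ord i)).
case: (ltnP n d.+2) => [lt_n|le_n]; last first.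
  rewrite T0 ?le_n ?orbT // big1 // => i _; rewrite big1 // => j _; apply: Tj.
  by rewrite gtn_eqF // (leq_trans (ltn_ord j)).
rewrite (bigD1 (Ordinal lt_m)) //= [X in _ + X]big1 ?addr0 => [|i ne].
  rewrite (bigD1 (Ordinal lt_n)) //= [X in _ + X]big1 ?addr0 // => j ne.
  by apply: Tj; rewrite eq_sym.
by apply: big1 => j _; apply: Ti; rewrite eq_sym.
Qed.

(* As C^(-1) is replaced by C^0, a vanishing term of the Jacobi identity may have
   a degree d other than the common degree N of the remaining terms. *)
Lemma dinj_HHclass N d (z : Zcocycle A d) : (d = N \/ (0 < d)%N /\ zval z = 0) ->
  exists2 z' : Zcocycle A N, dinj d (HHclass z) = dinj N (HHclass z') &
    forall W x (ev : A -> W), admissible N x ev ->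
      ceval (zval z) x ev = ceval (zval z') x ev.
Proof.
case=> [e|[d0 z0]]; first by subst N; exists z.
exists 0.
  have -> : z = 0 by apply: val_inj.
  by rewrite !(lin0 (@HHclass_linear _)) !(lin0 (@dinj_linear _ _ _)).
move=> W x ev adm; rewrite z0 (ceval0 adm).
have [lx _ [lev _]] := adm.
by case: d z z0 d0 => // d z _ _; exact: ceval0S.
Qed.

Lemma HHbracketC m n (f : HH A m) (g : HH A n) :
  HHbracket (dinj m f) (dinj n g)
  = - (bsign C m n *: HHbracket (dinj n g) (dinj m f)).
Proof.
have [f' ->] := HHclassP f; have [g' ->] := HHclassP g.
rewrite !HHbracket_dinj !Hbracket_class.
have e : (n + m).-1 = (m + n).-1 \/
    (0 < (n + m).-1)%N /\ zval (Zbracket g' f') = 0 by left; rewrite addnC.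
have [z -> hz] := dinj_HHclass e.
rewrite -scaleNr -(linZ _ _ (@dinj_linear _ _ _)) -(linZ _ _ (@HHclass_linear _)).
congr (dinj _ (HHclass _)); apply: Zcocycle_inj => W x ev adm.
rewrite ceval_zvalZ // -hz // scaleNr.
by apply: (ceval_bracketC _ _ erefl adm); exact: zval_cochain.
Qed.

Lemma HHbracket0l (y : HHtot A) : HHbracket 0 y = 0.
Proof. exact: (lin0 (HHbracketPl y)). Qed.

Lemma HHbracket0r (x : HHtot A) : HHbracket x 0 = 0.
Proof. exact: (lin0 (HHbracketPr x)). Qed.

Lemma dinj0 n : dinj n (0 : HH A n) = 0.
Proof. exact: (lin0 (@dinj_linear _ _ _)). Qed.

Lemma HHbracket00 (f g : HH A 0) : HHbracket (dinj 0 f) (dinj 0 g) = 0.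
Proof.
have [f' ->] := HHclassP f; have [g' ->] := HHclassP g.
rewrite HHbracket_dinj Hbracket_class.
rewrite (_ : Zbracket f' g' = 0); last by apply: val_inj; exact: bracket00.
by rewrite (lin0 (@HHclass_linear _)) dinj0.
Qed.

Lemma HHbracket_low n p (g : HH A n) (h : HH A p) : (n + p < 2)%N ->
  exists u : HH A 0, HHbracket (dinj n g) (dinj p h) = dinj 0 u.
Proof.
move=> lt2; rewrite HHbracket_dinj; move: (Hbracket g h).
have -> : (n + p).-1 = 0 by lia.
by move=> u; exists u.
Qed.

(** The true degree is negative. Either [f] and the inner bracket both lie in degree 0, or [g] and
    [h] do, and brackets within degree 0 vanish. *)
Lemma HHbracket_low_r m n p (f : HH A m) (g : HH A n) (h : HH A p) :
  (m + n + p < 2)%N ->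
  HHbracket (dinj m f) (HHbracket (dinj n g) (dinj p h)) = 0.
Proof.
case: (posnP m) => [m0|m_gt0] lt2.
  subst m; have [|u ->] := HHbracket_low g h; first by lia.
  exact: HHbracket00.
have [n0 p0] : n = 0 /\ p = 0 by lia.
by subst n p; rewrite HHbracket00 HHbracket0r.
Qed.

Lemma HHbracket_low_l m n p (f : HH A m) (g : HH A n) (h : HH A p) :
  (m + n + p < 2)%N ->
  HHbracket (HHbracket (dinj m f) (dinj n g)) (dinj p h) = 0.
Proof.
case: (posnP p) => [p0|p_gt0] lt2.
  subst p; have [|u ->] := HHbracket_low f g; first by lia.
  exact: HHbracket00.
have [m0 n0] : m = 0 /\ n = 0 by lia.
by subst m n; rewrite HHbracket00 HHbracket0l.
Qed.

Lemma HHbracket_jacobi m n p (f : HH A m) (g : HH A n) (h : HH A p) :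
  HHbracket (dinj m f) (HHbracket (dinj n g) (dinj p h))
  = HHbracket (HHbracket (dinj m f) (dinj n g)) (dinj p h)
    + bsign C m n *: HHbracket (dinj n g) (HHbracket (dinj m f) (dinj p h)).
Proof.
case: (leqP 2 (m + n + p)) => [le2|lt2]; last first.
  by rewrite HHbracket_low_l 1?HHbracket_low_r 1?HHbracket_low_r ?scaler0 ?addr0 //; lia.
have [f' ->] := HHclassP f; have [g' ->] := HHclassP g.
have [h' ->] := HHclassP h; rewrite !HHbracket_dinj !Hbracket_class.
pose N := (m + n + p - 2)%N; have eN : N.+2 = (m + n + p)%N by lia.
have hf := zval_cochain f'; have hg := zval_cochain g'; have hh := zval_cochain h'.
(* A term misses degree [N] only if its inner bracket pairs two elements of degree 0; it is then
   zero, in degree [N + 1]. *)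
have e1 : (m + (n + p).-1).-1 = N \/
    (0 < (m + (n + p).-1).-1)%N /\ zval (Zbracket f' (Zbracket g' h')) = 0.
  case: (posnP (n + p)) => [np|np]; last by left; lia.
  have [n0 p0] : n = 0 /\ p = 0 by lia.
  subst n p; right; split; first by lia.
  by rewrite /= bracket00 bracket0r.
have e2 : ((m + n).-1 + p).-1 = N \/
    (0 < ((m + n).-1 + p).-1)%N /\ zval (Zbracket (Zbracket f' g') h') = 0.
  case: (posnP (m + n)) => [mn|mn]; last by left; lia.
  have [m0 n0] : m = 0 /\ n = 0 by lia.
  subst m n; right; split; first by lia.
  by rewrite /= bracket00 bracket0l.
have e3 : (n + (m + p).-1).-1 = N \/
    (0 < (n + (m + p).-1).-1)%N /\ zval (Zbracket g' (Zbracket f' h')) = 0.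
  case: (posnP (m + p)) => [mp|mp]; last by left; lia.
  have [m0 p0] : m = 0 /\ p = 0 by lia.
  subst m p; right; split; first by lia.
  by rewrite /= bracket00 bracket0r.
have [z1 -> hz1] := dinj_HHclass e1; have [z2 -> hz2] := dinj_HHclass e2.
have [z3 -> hz3] := dinj_HHclass e3.
rewrite -(linZ _ _ (@dinj_linear _ _ _)) -(linZ _ _ (@HHclass_linear _)).
rewrite -(linD _ _ (@dinj_linear _ _ _)) -(linD _ _ (@HHclass_linear _)).
congr (dinj _ (HHclass _)); apply: Zcocycle_inj => W x ev adm.
rewrite [RHS](linD _ _ (ceval_linear adm)) ceval_zvalZ // -hz1 // -hz2 // -hz3 //.
exact: (ceval_jacobi hf hg hh eN adm).
Qed.
End Cohomology.

Theorem theorem3p5 (C : closedFieldType) (charC0 : [pchar C] =i pred0)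
    (A : assocConformalAlg C) :
  (forall (m n : nat) (f : precochain A m) (g : precochain A n),
     f \in cochain A m -> g \in cochain A n ->
     bracket f g \in cochain A (m + n).-1) /\
  exists br : HHtot A -> HHtot A -> HHtot A,
    [/\ (forall x, linear (br x)) /\ (forall y, linear (br^~ y)),
        forall (m n : nat) (f : Zcocycle A m) (g : Zcocycle A n),
          exists2 h : Zcocycle A (m + n).-1,
            zval h = bracket (zval f) (zval g) &
            br (dinj m (HHclass f)) (dinj n (HHclass g)) =
            dinj (m + n).-1 (HHclass h),
        forall (m n : nat) (f : HH A m) (g : HH A n),
          br (dinj m f) (dinj n g) =
          - (bsign C m n *: br (dinj n g) (dinj m f))
      & forall (m n p : nat) (f : HH A m) (g : HH A n) (h : HH A p),
          br (dinj m f) (br (dinj n g) (dinj p h)) =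
          br (br (dinj m f) (dinj n g)) (dinj p h)
          + bsign C m n *: br (dinj n g) (br (dinj m f) (dinj p h))].
Proof.
split; first exact: bracket_cochain.
exists (@HHbracket C A); split.
- by split; [exact: HHbracketPr | exact: HHbracketPl].
- move=> m n f g; exists (Zbracket f g) => //.
  by rewrite HHbracket_dinj Hbracket_class.
- exact: HHbracketC.
- exact: HHbracket_jacobi.
Qed.
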